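(* Assume $f\in C(\Omega;L^1(I))$ and suppose that for every $n\in\mathbb{N}$, $R_M(\widetilde{\mathcal F}_n)\to0$ as $M\to\infty$, where $\widetilde{\mathcal F}_n=\{\omega\mapsto|A_{\rm BC}\alpha(\omega)-F(\omega)|^2:\alpha\in\mathcal N_n\}$. Then for fixed $N\in\mathbb{N}$, with probability $1$ over the i.i.d. samples, \[ \lim_{n\to\infty}\lim_{M\to\infty}\|u_N-u_{N,n,M}\|_{L^2(\Omega;H^1(I))}=0 . \]
   Context: Consider $-u''(x;\omega)+\nu u(x;\omega)=f(x;\omega)$ on $I=(-1,1)$, $\nu\ge0$, with either homogeneous Dirichlet ($u(\pm1;\omega)=0$) or homogeneous Neumann ($u'(\pm1;\omega)=0$) boundary conditions, where $\omega\in\Omega=[a,b]^d$ ($a,b>0$) is uniformly distributed ($\mathbb P_\Omega$). Let $L_k$ be the $k$-th Legendre polynomial and $\phi_k=L_k+a_kL_{k+1}+b_kL_{k+2}$, $k=1,\dots,N-1$, with $a_k=0,b_k=-1$ in the Dirichlet case and $a_k=0$, $b_k=-\frac{k(k+1)}{(k+2)(k+3)}$ in the Neumann case. Let $S_{ij}=\int_I\phi_i'\phi_j'\,dx$, $M_{ij}=\int_I\phi_i\phi_j\,dx$, $F_j(\omega)=\int_If(x;\omega)\phi_j(x)\,dx$, and $A_{\rm BC}=S+\nu M$ (for the chosen boundary condition). Let $\alpha^*(\omega)=A_{\rm BC}^{-1}F(\omega)$ and $u_N(x;\omega)=\sum_{k=1}^{N-1}\alpha_k^*(\omega)\phi_k(x)$.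 Empirical loss: for i.i.d. $\omega_1,\omega_2,\dots\sim\mathbb P_\Omega$, $\mathcal L^M(\alpha)=\frac{|\Omega|}{M}\sum_{m=1}^M|A_{\rm BC}\alpha(\omega_m)-F(\omega_m)|^2$. Neural network classes: $\mathcal N_n^*$ is a nested sequence of feed-forward network classes $\mathbb{R}^d\to\mathbb{R}^{N-1}$ with the universal approximation property (for every compact $K$ and continuous $g$, $\lim_n\inf_{\hat g\in\mathcal N_n^*}\|\hat g-g\|_{C(K)}=0$); with $C_\alpha>\sup_\Omega|\alpha^*|$, $\sigma^*$ a bounded activation function with continuous inverse, $\sigma_\pm=\sup/\inf\sigma^*$, and $h$ the affine map $[\sigma_-,\sigma_+]\to[-C_\alpha,C_\alpha]$ with $h(\sigma_\pm)=\pm C_\alpha$, set $\mathcal N_n=\{h\circ\sigma^*(g):g\in\mathcal N_n^*\}$. Let $\widehat\alpha(n,M)$ be a minimizer of $\mathcal L^M$ over $\mathcal N_n$ (assumed to exist) and $u_{N,n,M}(x;\omega)=\sum_{k=1}^{N-1}\widehat\alpha(n,M)_k(\omega)\phi_k(x)$. Rademacher complexity: $R_M(\mathcal F)=\mathbb E\big[\sup_{g\in\mathcal F}\big|\frac1M\sum_{i=1}^M\varepsilon_ig(X_i)\big|\big]$ with $X_i$ i.i.d. $\sim\mathbb P_\Omega$ and $\varepsilon_i$ i.i.d. uniform on $\{\pm1\}$.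
   Formalization: The inner limit over M is read as a limit superior (for every ε, for all large n, for all large M the norm is below ε), since for arbitrary minimizers the limit over M need not exist. *)

(* Defs.v *)
From HB Require Import structures.
From mathcomp Require Import all_boot all_order all_algebra.
From mathcomp Require Import all_classical all_reals all_analysis.
Unset Printing Implicit Defensive.
Import Order.TTheory GRing.Theory Num.Theory numFieldTopology.Exports numFieldNormedType.Exports.
Local Open Scope classical_set_scope.
Local Open Scope ring_scope.

(* Borel (= product) sigma-algebra on R^d, represented as 'rV[R]_d.    *)
Section rV_measurable.
Context {R : realType} (d : nat).
Definition rV_coord : 'I_d -> 'rV[R]_d -> R := fun i x => x ord0 i.
Lemma rV_set0 : g_sigma_preimage rV_coord set0.
Proof. exact: sigma_algebra0. Qed.
Lemma rV_setC A : g_sigma_preimage rV_coord A -> g_sigma_preimage rV_coord (~` A).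
Proof. exact: sigma_algebraC. Qed.
Lemma rV_bigcup (F : _^nat) : (forall i, g_sigma_preimage rV_coord (F i)) ->
  g_sigma_preimage rV_coord (\bigcup_i (F i)).
Proof. exact: sigma_algebra_bigcup. Qed.
HB.instance Definition _ :=
  @isMeasurable.Build (measure_tuple_display default_measure_display)
  'rV[R]_d (g_sigma_preimage rV_coord) rV_set0 rV_setC rV_bigcup.
End rV_measurable.

Inductive BC := Dirichlet | Neumann.

Section Defs.
Context {R : realType}.

(* Legendre polynomials (Rodrigues' formula) *)
Definition legendre (k : nat) : {poly R} :=
  ((2 ^ k * k`!)%:R)^-1 *: (('X ^+ 2 - 1) ^+ k)^`(k).

Definition acoef (bc : BC) (k : nat) : R := 0.
Definition bcoef (bc : BC) (k : nat) : R :=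
  match bc with
  | Dirichlet => -1
  | Neumann => - ((k * k.+1)%:R / (k.+2 * k.+3)%:R)
  end.

Definition phi (bc : BC) (k : nat) : {poly R} :=
  legendre k + acoef bc k *: legendre k.+1 + bcoef bc k *: legendre k.+2.

Definition I_int : set R := `]-1, 1[%classic.
Local Notation leb := (@lebesgue_measure R).

(* basis index i : 'I_(N.-1) stands for k = i+1 *)
Definition Smat (bc : BC) (N : nat) : 'M[R]_(N.-1) :=
  \matrix_(i, j) Rintegral leb I_int
     (fun x => ((phi bc i.+1)^`()).[x] * ((phi bc j.+1)^`()).[x]).
Definition Mmat (bc : BC) (N : nat) : 'M[R]_(N.-1) :=
  \matrix_(i, j) Rintegral leb I_int
     (fun x => (phi bc i.+1).[x] * (phi bc j.+1).[x]).
Definition Abc (bc : BC) (N : nat) (nu : R) : 'M[R]_(N.-1) :=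
  Smat bc N + nu *: Mmat bc N.

Definition Fvec (bc : BC) (N d : nat) (f : 'rV[R]_d -> R -> R) (w : 'rV[R]_d)
  : 'cV[R]_(N.-1) :=
  \col_j Rintegral leb I_int (fun x => f w x * (phi bc j.+1).[x]).

Definition alphastar (bc : BC) (N d : nat) (nu : R) (f : 'rV[R]_d -> R -> R)
  (w : 'rV[R]_d) : 'cV[R]_(N.-1) :=
  invmx (Abc bc N nu) *m Fvec bc N d f w.

Definition sqn (n : nat) (v : 'cV[R]_n) : R := \sum_(i < n) (v i ord0) ^+ 2.
Definition eucl (n : nat) (v : 'cV[R]_n) : R := Num.sqrt (sqn n v).

Definition upoly (bc : BC) (N : nat) (c : 'cV[R]_(N.-1)) : {poly R} :=
  \sum_(i < N.-1) c i ord0 *: phi bc i.+1.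

Definition H1sq (p : {poly R}) : \bar R :=
  (\int[leb]_(x in I_int) ((p.[x]) ^+ 2 + ((p^`()).[x]) ^+ 2)%:E)%E.

Definition Omega (d : nat) (a b : R) : set 'rV[R]_d :=
  [set w | forall i, a <= w ord0 i <= b].

Definition sigma_plus (sigma : R -> R) : R := sup (range sigma).
Definition sigma_minus (sigma : R -> R) : R := inf (range sigma).
Definition haff (Calpha : R) (sigma : R -> R) (y : R) : R :=
  - Calpha + 2 * Calpha * (y - sigma_minus sigma)
                / (sigma_plus sigma - sigma_minus sigma).

Definition NNclass (d m : nat) (Calpha : R) (sigma : R -> R)
  (NNstar : nat -> set ('rV[R]_d -> 'cV[R]_m)) (n : nat)
  : set ('rV[R]_d -> 'cV[R]_m) :=
  [set (fun w => map_mx (haff Calpha sigma \o sigma) (g w)) | g in NNstar n].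

Definition LossM (bc : BC) (N d : nat) (nu a b : R) (f : 'rV[R]_d -> R -> R)
  (T : Type) (omega : nat -> T -> 'rV[R]_d) (M : nat) (t : T)
  (alpha : 'rV[R]_d -> 'cV[R]_(N.-1)) : R :=
  (b - a) ^+ d / M%:R *
  \sum_(m < M) sqn N.-1 (Abc bc N nu *m alpha (omega m t) - Fvec bc N d f (omega m t)).

Definition Ftilde (bc : BC) (N d : nat) (nu : R) (f : 'rV[R]_d -> R -> R)
  (NN : set ('rV[R]_d -> 'cV[R]_(N.-1))) : set ('rV[R]_d -> R) :=
  [set (fun w => sqn N.-1 (Abc bc N nu *m alpha w - Fvec bc N d f w)) | alpha in NN].

(* Rademacher complexity R_M(F) = E[ sup_{g in F} |1/M sum_i eps_i g(X_i)| ],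
   with X_1..X_M i.i.d. realised by the random variables X i (i < M) on
   (T,P), and the expectation over the i.i.d. uniform signs written as the
   exact average over all 2^M sign vectors. *)
Definition sgn (s : bool) : R := if s then 1 else -1.
Definition Rademacher (dT : measure_display) (T : measurableType dT)
  (P : probability T R) (d : nat) (X : nat -> T -> 'rV[R]_d)
  (F : set ('rV[R]_d -> R)) (M : nat) : \bar R :=
  (((2 ^ M)%:R)^-1%:E *
   \sum_(s : {ffun 'I_M -> bool})
     \int[P]_t ereal_sup
        [set (`| M%:R^-1 * \sum_(i < M) sgn (s i) * g (X i t) |)%:E | g in F])%E.

(* squared L^2(Omega; H^1(I)) distance (Lebesgue measure on Omega
   = |Omega| * P_Omega) between u_N and u_{N,n,M} *)
Definition err2 (bc : BC) (N d : nat) (nu a b : R) (f : 'rV[R]_d -> R -> R)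
  (PO : probability 'rV[R]_d R) (alphahat : 'rV[R]_d -> 'cV[R]_(N.-1)) : \bar R :=
  ((((b - a) ^+ d)%R)%:E *
   \int[PO]_(w in Omega d a b)
      H1sq (upoly bc N (alphastar bc N d nu f w) - upoly bc N (alphahat w)))%E.

End Defs.

(* Main.v *)
(* Everything reduces to one estimate: writing g_alpha = |A alpha - F|^2, almost
   surely, for every n, the mean of g_alpha under P_Omega exceeds its empirical
   mean by at most o(1), uniformly over alpha in N_n.  For n large, N_n contains
   a network close to alpha^* uniformly on Omega, so the empirical minimizer has
   small empirical loss, hence small mean loss; since A is positive definite (the
   derivatives phi_k' have pairwise distinct degrees), its mean loss dominates
   the squared L^2(Omega; H^1(I)) error.

   The uniform law of large numbers is obtained without a concentration
   inequality.  Let H(x_1, ..., x_m) = sup_g |sum_i (E g - g(x_i))|.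
   Symmetrization gives E H <= 2 m R_m.  As H is subadditive under concatenation
   of samples, M (E g - P_M g) is at most the sum of H over about M / m
   disjoint blocks of length m, up to O(m sqrt M); these block values are
   bounded i.i.d. variables, so the strong law, needed only along a number of
   blocks that is a perfect square and hence provable by second moments, bounds
   limsup_M sup_g (E g - P_M g) by E H / m <= 2 R_m, for every m. *)
Require Import Defs.
From HB Require Import structures.
From mathcomp Require Import all_boot all_order all_algebra.
From mathcomp Require Import ring lra zify.
From mathcomp Require Import all_classical all_reals all_analysis.
From mathcomp Require Import measurable_realfun.
Import Order.TTheory GRing.Theory Num.Theory numFieldTopology.Exports numFieldNormedType.Exports.
Local Open Scope classical_set_scope.
Local Open Scope ring_scope.

(** * Measurability and laws on row vectors *)

Section rV_measurability.
Context {R : realType}.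

Lemma g_sigma_preimage_coord d : @measurable _ 'rV[R]_d =
  <<s \bigcup_(i in [set: 'I_d]) preimage_set_system setT (rV_coord d i) measurable >>.
Proof.
rewrite [LHS]/measurable /= /g_sigma_preimage -bigcup_seq; congr (<<s _ >>).
by apply: eq_bigcupl; split => i _ //=; exact: mem_index_enum.
Qed.

Lemma measurable_rV_coord d (i : 'I_d) :
  measurable_fun setT (fun w : 'rV[R]_d => w ord0 i).
Proof.
move=> _ B mB; rewrite g_sigma_preimage_coord; apply: sub_sigma_algebra.
by exists i => //; exists B.
Qed.

Lemma measurable_fun_rV d0 (S : measurableType d0) d (Z : S -> 'rV[R]_d) :
  (forall i, measurable_fun setT (fun t => Z t ord0 i)) -> measurable_fun setT Z.
Proof.
move=> mZ; apply: (@measurability _ _ _ _ _ _ _ (g_sigma_preimage_coord d)).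
move=> _ [_ [i _ [B mB <-]] <-].
rewrite !setTI; rewrite -[X in measurable X]setTI; exact: mZ.
Qed.

(** Boxes are stable under intersection and generate the sigma-algebra, so laws on row vectors need
    only be compared on them. *)
Definition box d (B : 'I_d -> set R) : set 'rV[R]_d :=
  [set w | forall i, B i (w ord0 i)].

Lemma boxE d (B : 'I_d -> set R) :
  box d B = \bigcap_(i in [set: 'I_d]) (fun w => w ord0 i) @^-1` B i.
Proof. by apply/seteqP; split => [w wB i _|w wB i]; exact: wB. Qed.

Lemma measurable_box d (B : 'I_d -> set R) :
  (forall i, measurable (B i)) -> measurable (box d B).
Proof.
move=> mB; rewrite boxE; apply: fin_bigcap_measurable => // i _.
rewrite -[X in measurable X]setTI; exact: measurable_rV_coord.
Qed.

(** Balls of the sup norm are boxes, and an open set is the union of the countably many boxes with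
    rational centre and radius 1/(n+1) that it contains. *)
Lemma open_measurable_rV d (U : set 'rV[R]_d) : open U -> measurable U.
Proof.
move=> oU.
pose b (q : 'rV[rat]_d * nat) :=
  box d (fun i => ball (ratr (q.1 ord0 i) : R) (q.2.+1%:R^-1 : R)).
have -> : U = \bigcup_(q in [set q | b q `<=` U]) b q.
  apply/seteqP; split => [x Ux|x [q /= bU]]; last exact: bU.
  have /nbhs_ballP[e /= e0 eU] : nbhs x U by exact: open_nbhs_nbhs.
  (* A box of radius 1/(n+1) that contains x stays within twice that radius of x, hence the factor
     2. *)
  have [n ne] : exists n, 2 * n.+1%:R^-1 < e.
    exists (Num.truncn (2 / e)).
    by rewrite ltr_pdivrMr// mulrC -ltr_pdivrMr// truncnS_gt.
  have Q i : {q : rat | ball (ratr q : R) (n.+1%:R^-1 : R) (x ord0 i)}.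
    apply: cid; have [|q] := @rat_in_itvoo R (x ord0 i - n.+1%:R^-1) (x ord0 i + n.+1%:R^-1).
      by rewrite ltrD2l gt0_cp// invr_gt0.
    rewrite in_itv/= => /andP[q1 q2]; exists q; rewrite /ball/= ltr_norml; move: q1 q2.
    by move: (_^-1) (x _ _) (ratr q) => r y z *; apply/andP; split; lra.
  exists (\row_i sval (Q i), n) => /=.
    move=> y; rewrite /b/= => yb; apply: eU; split => // i j.
    rewrite ord1; have := yb j; rewrite mxE => yj; have xj := svalP (Q j).
    apply: (le_ball (ltW ne)); rewrite mulr_natl mulr2n.
    by apply: ball_triangle yj; exact: ball_sym.
  by move=> i; rewrite mxE; exact: svalP (Q i).
rewrite bigcup_mkcond; apply: countable_bigcupT_measurable => [|q].
  exact: countableP.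
by case: ifPn => // _; apply: measurable_box => i; exact: measurable_ball.
Qed.

Definition supabs d (F : set ('rV[R]_d -> R)) (w : 'rV[R]_d) : \bar R :=
  ereal_sup [set (`|g w|)%:E | g in F].

(* The supremum over a possibly uncountable class is measurable because a supremum of
   continuous functions is lower semicontinuous. *)
Lemma measurable_supabs d (F : set ('rV[R]_d -> R)) :
  (forall g, F g -> continuous g) -> measurable_fun [set: 'rV[R]_d] (supabs d F).
Proof.
move=> cF; apply: (@measurability _ _ _ _ _ _ _ (ErealGenOInfty.measurableE R)).
move=> _ [_ [r ->] <-]; rewrite setTI; apply: open_measurable_rV.
rewrite (_ : _ @^-1` _ = \bigcup_(g in F) (fun w => `|g w|) @^-1` `]r, +oo[).
  apply: bigcup_open => g Fg; apply: open_comp; last exact: rray_open.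
  by move=> x _; apply: continuous_comp; [exact: cF|exact: norm_continuous].
apply/seteqP; split => w /=.
  rewrite in_itv/= andbT => /ereal_sup_gtP[_ [g Fg <-]]; rewrite lte_fin => rg.
  by exists g => //=; rewrite in_itv/= andbT.
move=> [g Fg /=]; rewrite !in_itv/= !andbT => rg.
by apply/ereal_sup_gtP; exists (`|g w|)%:E => //; exists g.
Qed.

(** The two image measures agree on the pi-system of boxes, hence on the sigma-algebra it generates;
    change of variables carries this over to integrals. *)
Lemma eq_law_integral d1 d2 (S1 : measurableType d1) (S2 : measurableType d2)
    (P1 : probability S1 R) (P2 : probability S2 R) d
    (Z1 : S1 -> 'rV[R]_d) (Z2 : S2 -> 'rV[R]_d) :
  measurable_fun setT Z1 -> measurable_fun setT Z2 ->
  (forall B : 'I_d -> set R, (forall i, measurable (B i)) ->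
     P1 (Z1 @^-1` box d B) = P2 (Z2 @^-1` box d B)) ->
  forall h : 'rV[R]_d -> \bar R, measurable_fun [set: 'rV[R]_d] h -> (forall w, 0 <= h w)%E ->
  (\int[P1]_t h (Z1 t) = \int[P2]_t h (Z2 t))%E.
Proof.
move=> m1 m2 PB h mh h0.
have E1 := @ge0_integral_pushforward _ _ _ _ R Z1 m1 P1 setT h measurableT mh (fun x _ => h0 x).
have E2 := @ge0_integral_pushforward _ _ _ _ R Z2 m2 P2 setT h measurableT mh (fun x _ => h0 x).
rewrite !preimage_setT in E1 E2; rewrite -[LHS]E1 -[RHS]E2.
apply: eq_measure_integral => A mA _.
pose G := [set box d B | B in [set B : 'I_d -> set R | forall i, measurable (B i)]].
have GT : G setT by exists (fun=> setT) => //; apply/seteqP; split.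
have mG : @measurable _ 'rV[R]_d = <<s G >>.
  apply/seteqP; split; last first.
    apply: smallest_sub; first exact: sigma_algebra_measurable.
    by move=> _ [B mB <-]; exact: measurable_box.
  rewrite [X in X `<=` _]g_sigma_preimage_coord; apply: smallest_sub.
    exact: smallest_sigma_algebra.
  move=> _ [i _ [B mB <-]]; apply: sub_sigma_algebra.
  (* The preimage of [B] under one coordinate is a box whose other sides are the whole line. *)
  exists (fun j => if j == i then B else setT); first by move=> j /=; case: ifP.
  apply/seteqP; split => w /=; first by move=> /(_ i); rewrite eqxx; split.
  by move=> [_ Bw] j; case: eqP => // ->.
have := @measure_unique _ R _ G (fun=> setT) mG _ _ _
  (pushforward P1 Z1) (pushforward P2 Z2) _ _ A mA; apply.
- move=> _ _ [B mB <-] [C mC <-]; exists (fun i => B i `&` C i).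
    by move=> i; exact: measurableI.
  by apply/seteqP; split => [w BC|w [Bw Cw] i]; [split=> i; have [] := BC i|split].
- by move=> _; exact: GT.
- by apply/seteqP; split => // x _; exists 0.
- by move=> _ [B mB <-]; exact: PB.
- by move=> _; rewrite -[X in (X < _)%E]/(P1 (Z1 @^-1` setT)) preimage_setT probability_setT ltry.
Qed.

(* The library integral of a nonnegative function is a supremum over simple functions, so
   monotonicity needs no measurability; this matters for the supremum inside [Rademacher]. *)
Lemma ge0_le_integral_nonmeas d1 (S : measurableType d1)
    (mu : {measure set S -> \bar R}) (D : set S) (f g : S -> \bar R) :
  (forall x, D x -> 0 <= f x)%E -> (forall x, D x -> f x <= g x)%E ->
  (\int[mu]_(x in D) f x <= \int[mu]_(x in D) g x)%E.
Proof.
move=> f0 fg.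
have g0 x : D x -> (0 <= g x)%E by move=> Dx; exact: le_trans (f0 _ Dx) (fg _ Dx).
rewrite !ge0_integralE//; apply: ereal_sup_le => _ [h hf <-]; exists h => // x.
apply: le_trans (hf x) _; rewrite /patch; case: ifPn => //; rewrite inE; exact: fg.
Qed.

End rV_measurability.

(** * Independent samples *)

Section samples.
Context {R : realType}.

(* A sigma-algebra and a topology are both available on row vectors only, so a sample of
   m points of R^d is flattened into a single row of length m * d. *)
Definition blk m d (w : 'rV[R]_(m * d)) (i : 'I_m) : 'rV[R]_d :=
  \row_j w ord0 (mxvec_index i j).

Definition pack m d (x : 'I_m -> 'rV[R]_d) : 'rV[R]_(m * d) :=
  mxvec (\matrix_i x i).

Lemma packK m d (x : 'I_m -> 'rV[R]_d) i : blk m d (pack m d x) i = x i.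
Proof. by apply/rowP => j; rewrite !mxE mxvecE !mxE. Qed.

Lemma continuous_blk m d i : continuous (fun w => blk m d w i).
Proof.
move=> w A /nbhs_ballP[e /= e0 eA]; apply/nbhs_ballP; exists e => //= w' [_ bw].
by apply: eA; split => // k j; rewrite !mxE.
Qed.

Lemma measurable_pack d0 (S : measurableType d0) m d (x : 'I_m -> S -> 'rV[R]_d) :
  (forall i, measurable_fun setT (x i)) ->
  measurable_fun setT (fun t => pack m d (x ^~ t)).
Proof.
move=> mx; apply: measurable_fun_rV => k; case/mxvec_indexP: k => i j.
rewrite (_ : (fun t => _) = (fun w : 'rV[R]_d => w ord0 j) \o x i).
  by apply: measurableT_comp => //; exact: measurable_rV_coord.
by apply/funext => t /=; rewrite mxvecE mxE.
Qed.

Lemma measurable_blk m d i :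
  measurable_fun [set: 'rV[R]_(m * d)] (fun w => blk m d w i).
Proof.
apply: measurable_fun_rV => j.
rewrite (_ : (fun t => _) = (fun w : 'rV[R]_(m * d) => w ord0 (mxvec_index i j))).
  exact: measurable_rV_coord.
by apply/funext => w; rewrite mxE.
Qed.

Context (d : nat) (PO : probability 'rV[R]_d R).

(** One product formula encodes both independence and the common law [PO]: full sets in all
    positions but one give the marginals. *)
Definition iid d0 (S : measurableType d0) (P : probability S R) m
    (x : 'I_m -> S -> 'rV[R]_d) :=
  (forall i, measurable_fun setT (x i)) /\
  forall A : 'I_m -> set 'rV[R]_d, (forall i, measurable (A i)) ->
    P [set t | forall i, A i (x i t)] = (\prod_i PO (A i))%E.

(* Exchanging the i-th points of two samples changes the sign of the i-th term of a
   symmetrized sum. *)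
Definition swap_samples (V : Type) m (s : 'I_m -> bool) (u v : 'I_m -> V) (k : 'I_(m + m)) : V :=
  match fintype.split k with
  | inl i => if s i then u i else v i
  | inr i => if s i then v i else u i
  end.

Lemma swap_samples_lshift V m s u v i :
  swap_samples V m s u v (lshift m i) = if s i then u i else v i.
Proof. by rewrite /swap_samples (unsplitK (inl i)). Qed.

Lemma swap_samples_rshift V m s u v i :
  swap_samples V m s u v (rshift m i) = if s i then v i else u i.
Proof. by rewrite /swap_samples (unsplitK (inr i)). Qed.

Lemma iid_marginal d0 (S : measurableType d0) (P : probability S R) m
    (x : 'I_m -> S -> 'rV[R]_d) i (A : set 'rV[R]_d) :
  iid d0 S P m x -> measurable A -> P (x i @^-1` A) = PO A.
Proof.
move=> [_ ix] mA; pose B j := if j == i then A else setT.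
have mB j : measurable (B j) by rewrite /B; case: ifP.
have := ix _ mB; rewrite (bigD1 i)//= big1 ?mule1 => [|j /negbTE ji].
  rewrite /B eqxx => <-; congr (P _); apply/seteqP; split => t /=.
    by move=> At j; case: eqP => // ->.
  by move=> /(_ i); rewrite eqxx.
by rewrite /B ji; exact: probability_setT.
Qed.

(** A box in the flattened row is a product of boxes, one per sample point, so the product formula
    determines the joint law, whatever probability space carries the sample. *)
Lemma iid_integral d1 d2 (S1 : measurableType d1) (S2 : measurableType d2)
    (P1 : probability S1 R) (P2 : probability S2 R) m
    (x : 'I_m -> S1 -> 'rV[R]_d) (y : 'I_m -> S2 -> 'rV[R]_d) :
  iid d1 S1 P1 m x -> iid d2 S2 P2 m y ->
  forall h : 'rV[R]_(m * d) -> \bar R,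
    measurable_fun [set: 'rV[R]_(m * d)] h -> (forall w, 0 <= h w)%E ->
  (\int[P1]_t h (pack m d (x ^~ t)) = \int[P2]_t h (pack m d (y ^~ t)))%E.
Proof.
move=> [mx ix] [my iy]; apply: eq_law_integral; [exact: measurable_pack..|].
move=> B mB.
have pre d3 (S : measurableType d3) (z : 'I_m -> S -> 'rV[R]_d) :
    (fun t => pack m d (z ^~ t)) @^-1` box (m * d) B =
    [set t | forall i, box d (fun j => B (mxvec_index i j)) (z i t)].
  apply/seteqP; split => [t /= Bt i j|t /= Bt k].
    by have := Bt (mxvec_index i j); rewrite mxvecE mxE.
  by case/mxvec_indexP: k => i j; rewrite mxvecE mxE; exact: Bt.
have mB' i : measurable (box d (fun j => B (mxvec_index i j))).
  by apply: measurable_box.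
by rewrite !pre; apply: etrans (ix _ mB') (esym (iy _ mB')).
Qed.

(** On the product space the two samples are independent, and exchanging points only permutes
    factors of the product formula. With [xpredT] this is plain concatenation. *)
Lemma iid_swap d1 d2 (S1 : measurableType d1) (S2 : measurableType d2)
    (P1 : probability S1 R) (P2 : probability S2 R) m
    (x : 'I_m -> S1 -> 'rV[R]_d) (y : 'I_m -> S2 -> 'rV[R]_d)
    (s : 'I_m -> bool) :
  iid d1 S1 P1 m x -> iid d2 S2 P2 m y ->
  iid _ (S1 * S2)%type (P1 \x P2)%E (m + m)
    (fun i t => swap_samples _ m s (x ^~ t.1) (y ^~ t.2) i).
Proof.
move=> [mx ix] [my iy]; split.
  move=> k; rewrite /swap_samples; case: (fintype.split k) => j; case: (s j);
    solve [exact: measurableT_comp (mx j) measurable_fst |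
           exact: measurableT_comp (my j) measurable_snd].
move=> A mA.
(* [A1 i] and [A2 i] are the constraints that fall on the i-th point of [x] and of [y] once the
   exchanges are undone. *)
pose A1 i := A (if s i then lshift m i else rshift m i).
pose A2 i := A (if s i then rshift m i else lshift m i).
rewrite (_ : [set t | _] =
  [set t | forall i, A1 i (x i t)] `*` [set t | forall i, A2 i (y i t)]); last first.
  apply/seteqP; split => [t /= At|t /= [A1t A2t] k].
    split=> i; rewrite /A1 /A2; have := At (lshift m i); have := At (rshift m i).
      by rewrite swap_samples_lshift swap_samples_rshift; case: (s i).
    by rewrite swap_samples_lshift swap_samples_rshift; case: (s i).
  rewrite -[k]splitK; case: (fintype.split k) => i;
    rewrite /= ?swap_samples_lshift ?swap_samples_rshift;
    by have := A1t i; have := A2t i; rewrite /A1 /A2; case: (s i).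
have m1 : measurable [set t | forall i, A1 i (x i t)].
  rewrite (_ : mkset _ = \bigcap_(i in [set: 'I_m]) x i @^-1` A1 i).
    apply: fin_bigcap_measurable => // i _.
    by rewrite -[X in measurable X]setTI; apply: mx => //; exact: mA.
  by apply/seteqP; split => [t h i _|t h i]; exact: h.
have m2 : measurable [set t | forall i, A2 i (y i t)].
  rewrite (_ : mkset _ = \bigcap_(i in [set: 'I_m]) y i @^-1` A2 i).
    apply: fin_bigcap_measurable => // i _.
    by rewrite -[X in measurable X]setTI; apply: my => //; exact: mA.
  by apply/seteqP; split => [t h i _|t h i]; exact: h.
apply: (etrans (product_measure1E P1 P2 m1 m2)).
have mA1 i : measurable (A1 i) by exact: mA.
have mA2 i : measurable (A2 i) by exact: mA.
apply: (etrans (congr2 mule (ix _ mA1) (iy _ mA2))).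
rewrite -big_split/= big_split_ord/= -big_split/=.
by apply: eq_bigr => i _; rewrite /A1 /A2; case: (s i) => //; rewrite muleC.
Qed.

(** Independence is given on initial segments of the sequence; full sets at the indices missed by
    [e] reduce any injectively indexed finite family to that case. *)
Lemma iid_subfamily d0 (T : measurableType d0) (P : probability T R)
    (omega : nat -> T -> 'rV[R]_d) :
  (forall m, measurable_fun setT (omega m)) ->
  (forall m (A : set 'rV[R]_d), measurable A -> P (omega m @^-1` A) = PO A) ->
  (forall (k : nat) (A : nat -> set 'rV[R]_d), (forall j, measurable (A j)) ->
     P (\bigcap_(j in `I_k) (omega j @^-1` A j)) = (\prod_(j < k) P (omega j @^-1` A j))%E) ->
  forall m (e : 'I_m -> nat), injective e -> iid _ T P m (fun i => omega (e i)).
Proof.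
move=> mo lo io m e ie; split=> [i|A mA]; first exact: mo.
pose B j := if [pick i | e i == j] is Some i then A i else setT.
have Be i : B (e i) = A i.
  by rewrite /B; case: pickP => [i' /eqP/ie -> //|/(_ i)]; rewrite eqxx.
have mB j : measurable (B j) by rewrite /B; case: pickP.
pose k := (\max_i e i).+1.
have ek i : (e i < k)%N by rewrite ltnS; exact: leq_bigmax.
transitivity (P (\bigcap_(j in `I_k) omega j @^-1` B j)).
  congr (P _); apply/seteqP; split => [t /= At j _|t /= Bt i].
    by rewrite /B/=; case: pickP => // i /eqP <-; exact: At.
  by rewrite -Be; exact: Bt (e i) (ek i).
rewrite io//.
rewrite (eq_bigr (fun j : 'I_k => PO (B j))) => [|j _]; last by rewrite lo.
rewrite (bigID (fun j : 'I_k => [exists i, e i == j]))/=.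
rewrite [X in (_ * X)%E]big1 ?mule1; last first.
  move=> j /existsPn ne; rewrite /B; case: pickP => [i ei|_].
    by have := ne i; rewrite ei.
  exact: probability_setT.
have ie' : injective (fun i => Ordinal (ek i)) by move=> i j [] /ie.
rewrite (eq_bigl (fun j => j \in [set Ordinal (ek i) | i : 'I_m])%SET); last first.
  move=> j; apply/existsP/imsetP => [[i /eqP ij]|[i _ ->]]; exists i => //.
  exact: val_inj.
rewrite big_imset/=; last by move=> i j _ _; exact: ie'.
by apply: eq_bigr => i _; rewrite Be.
Qed.

End samples.

(** * Symmetrization *)

Lemma fun_subr_continuous {R : realType} (X : topologicalType) (f g : X -> R) :
  continuous f -> continuous g -> continuous (fun x => f x - g x).
Proof. by move=> cf cg x; apply: cvgB; [exact: cf|exact: cg]. Qed.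

Lemma fun_mulr_continuous {R : realType} (X : topologicalType) (f g : X -> R) :
  continuous f -> continuous g -> continuous (fun x => f x * g x).
Proof. by move=> cf cg x; apply: cvgM; [exact: cf|exact: cg]. Qed.

Lemma sum_continuous {R : realType} (X : topologicalType) (I : finType) (f : I -> X -> R) :
  (forall i, continuous (f i)) -> continuous (fun x => \sum_i f i x).
Proof.
move=> cf; apply: continuous_big => [|i _]; last exact: cf.
exact: add_continuous.
Qed.

Section bounded.
Context {R : realType} d0 (S : measurableType d0) (P : probability S R).

Lemma bounded_integrable (f : S -> R) C : measurable_fun setT f ->
  (forall t, `|f t| <= C) -> P.-integrable setT (EFin \o f).
Proof.
move=> mf bf; apply: measurable_bounded_integrable => //.
  by rewrite (le_lt_trans (probability_le1 P measurableT))// ltry.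
exists C; split; first exact: num_real.
by move=> x Cx t _ /=; rewrite (le_trans (bf t))// ltW.
Qed.

Lemma prob_integral_cst (r : \bar R) : (\int[P]_t r = r)%E.
Proof. by rewrite (integral_cst P measurableT r) [X in (_ * X)%E]probability_setT mule1. Qed.

End bounded.

Section symmetrization.
Context {R : realType} (d : nat) (PO : probability 'rV[R]_d R).
Context (G : set ('rV[R]_d -> R)) (C : R).
Context (G0 : G !=set0).
Context (cG : forall g, G g -> continuous g).
Context (bG : forall g, G g -> forall w, 0 <= g w <= C).

Definition mean (g : 'rV[R]_d -> R) : R := fine (\int[PO]_w (g w)%:E)%E.

(** [supabs] of this class is the subadditive function H whose values on disjoint blocks are
    averaged by the strong law. *)
Definition dev_class m : set ('rV[R]_(m * d) -> R) :=
  [set (fun w => \sum_(i < m) (mean g - g (blk m d w i))) | g in G].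

Definition rad_class m (s : 'I_m -> bool) : set ('rV[R]_(m * d) -> R) :=
  [set (fun w => \sum_(i < m) sgn (s i) * g (blk m d w i)) | g in G].

(** The left half of the row is the sample, the right half a ghost sample that stands in for the
    mean. *)
Definition sym_class m (s : 'I_m -> bool) : set ('rV[R]_((m + m) * d) -> R) :=
  [set (fun w => \sum_(i < m) sgn (s i) *
      (g (blk (m + m) d w (rshift m i)) - g (blk (m + m) d w (lshift m i)))) | g in G].

Lemma continuous_eval_blk m (i : 'I_m) g : G g ->
  continuous (fun w => g (blk m d w i)).
Proof.
by move=> Gg w; apply: continuous_comp; [exact: continuous_blk|exact: cG].
Qed.

Lemma dev_class_continuous m h : dev_class m h -> continuous h.
Proof.
move=> [g Gg <-]; apply: sum_continuous => i.
by apply: fun_subr_continuous; [exact: cst_continuous|exact: continuous_eval_blk].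
Qed.

Lemma rad_class_continuous m s h : rad_class m s h -> continuous h.
Proof.
move=> [g Gg <-]; apply: sum_continuous => i.
by apply: fun_mulr_continuous; [exact: cst_continuous|exact: continuous_eval_blk].
Qed.

Lemma sym_class_continuous m s h : sym_class m s h -> continuous h.
Proof.
move=> [g Gg <-]; apply: sum_continuous => i.
by apply: fun_mulr_continuous; [exact: cst_continuous|
  apply: fun_subr_continuous; exact: continuous_eval_blk].
Qed.

Lemma supabs_ge0 k (F : set ('rV[R]_k -> R)) w : F !=set0 -> (0 <= supabs k F w)%E.
Proof. by move=> [g Fg]; apply: le_ereal_sup_tmp; exists (`|g w|)%:E => //; exists g. Qed.

Lemma le_supabs k (F : set ('rV[R]_k -> R)) w g : F g -> ((`|g w|)%:E <= supabs k F w)%E.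
Proof. by move=> Fg; apply: ereal_sup_ubound; exists g. Qed.

Lemma measurable_class g : G g -> measurable_fun [set: 'rV[R]_d] g.
Proof.
move=> Gg; apply: (@measurability _ _ _ _ _ _ _ (RGenOInfty.measurableE R)) => _ [_ [r ->] <-].
rewrite setTI; apply: open_measurable_rV; apply: open_comp; last exact: rray_open.
by move=> x _; exact: cG.
Qed.

Context d0 (T : measurableType d0) (P : probability T R) (m : nat)
  (x : 'I_m -> T -> 'rV[R]_d).
Context (ix : iid d PO d0 T P m x).

Lemma mean_sample g i : G g -> (\int[P]_t (g (x i t))%:E = (mean g)%:E)%E.
Proof.
move=> Gg; have mg := measurable_class g Gg; have mx := ix.1 i.
have g0 w : (0 <= (g w)%:E)%E by rewrite lee_fin; case/andP: (bG g Gg w).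
rewrite fineK; last first.
  rewrite (integrable_fin_num measurableT)//; apply: (bounded_integrable _ _ _ _ C mg) => w.
  by have /andP[? ?] := bG g Gg w; rewrite ger0_norm.
have mEg : measurable_fun [set: 'rV[R]_d] (EFin \o g) by exact/measurable_EFinP.
have := @ge0_integral_pushforward _ _ _ _ R (x i) mx P setT _ measurableT mEg (fun w _ => g0 w).
rewrite preimage_setT => <-; apply: eq_measure_integral => A mA _.
exact: iid_marginal d PO _ _ _ _ _ i A ix mA.
Qed.

Lemma dev_le_ghost g (u : 'I_m -> 'rV[R]_d) : G g ->
  ((`|\sum_(i < m) (mean g - g (u i))|)%:E <=
    \int[P]_t supabs _ (sym_class m xpredT)
       (pack (m + m) d (swap_samples _ m xpredT u (x ^~ t))))%E.
Proof.
move=> Gg; have mg := measurable_class g Gg.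
pose f t := \sum_(i < m) (g (x i t) - g (u i)).
have mgx i : measurable_fun setT (fun t => g (x i t)).
  exact: measurableT_comp mg (ix.1 i).
have ig i : P.-integrable setT (fun t => (g (x i t))%:E).
  apply: (bounded_integrable _ _ _ _ C (mgx i)) => t.
  by have /andP[? ?] := bG g Gg (x i t); rewrite ger0_norm.
have ic i : P.-integrable setT (fun t : T => (g (u i))%:E).
  exact: (bounded_integrable _ _ _ _ `|g (u i)| (measurable_cst _)).
have -> : (`|\sum_(i < m) (mean g - g (u i))|)%:E = (`|\int[P]_t (f t)%:E|)%E.
  rewrite -abse_EFin -sumEFin; congr (`|_|)%E.
  under [RHS]eq_integral do rewrite /f -sumEFin.
  rewrite integral_sum//; last first.
    move=> i; rewrite (_ : (fun t => _) = (fun t => (g (x i t))%:E) \- (fun=> (g (u i))%:E))%E//.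
    exact: integrableB.
  apply: eq_bigr => i _.
  rewrite (_ : (fun t => _) = (fun t => (g (x i t))%:E) \- (fun=> (g (u i))%:E))%E//.
  by rewrite integralB// mean_sample// prob_integral_cst EFinB.
apply: le_trans (le_abse_integral _ measurableT _) _.
  apply/measurable_EFinP; apply: measurable_sum => i.
  by apply: measurable_funB => //; exact: mgx.
apply: ge0_le_integral_nonmeas => [t _|t _]; first exact: abse_ge0.
rewrite abse_EFin.
pose h (w : 'rV[R]_((m + m) * d)) := \sum_(i < m) sgn true *
   (g (blk (m + m) d w (rshift m i)) - g (blk (m + m) d w (lshift m i))) : R.
rewrite (_ : f t = h (pack (m + m) d (swap_samples _ m xpredT u (x ^~ t)))).
  by apply: le_supabs; exists g.
apply: eq_bigr => i _.
by rewrite !packK swap_samples_lshift swap_samples_rshift /= mul1r.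
Qed.

(** Ghost sample, exchange of points, triangle inequality. The bound holds for each fixed sign
    pattern, so no averaging over signs is needed here. *)
Lemma symmetrization (s : 'I_m -> bool) :
  (\int[P]_t supabs _ (dev_class m) (pack m d (x ^~ t)) <=
   2%:E * \int[P]_t supabs _ (rad_class m s) (pack m d (x ^~ t)))%E.
Proof.
have sym0 s' : sym_class m s' !=set0 by case: G0 => g Gg; eexists; exists g.
have rad0 : rad_class m s !=set0 by case: G0 => g Gg; eexists; exists g.
have dev0 : dev_class m !=set0 by case: G0 => g Gg; eexists; exists g.
pose W s' := supabs _ (sym_class m s').
have W0 s' w : (0 <= W s' w)%E by exact: supabs_ge0.
have mW s' : measurable_fun [set: 'rV[R]_((m + m) * d)] (W s').
  by apply: measurable_supabs => g; exact: sym_class_continuous.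
pose Z s' (t : T * T) := pack (m + m) d (swap_samples _ m s' (x ^~ t.1) (x ^~ t.2)).
have iZ s' := iid_swap d PO _ _ _ _ P P m x x s' ix ix.
have mZ s' : measurable_fun setT (Z s') by apply: measurable_pack; exact: (iZ s').1.
have mWZ s1 s2 : measurable_fun setT (fun t => W s1 (Z s2 t)).
  exact: measurableT_comp (mW s1) (mZ s2).
pose V t := supabs _ (rad_class m s) (pack m d (x ^~ t)).
have V0 t : (0 <= V t)%E by exact: supabs_ge0.
have mV : measurable_fun setT V.
  apply: measurableT_comp; last by apply: measurable_pack; exact: ix.1.
  by apply: measurable_supabs => g; exact: rad_class_continuous.
apply: (@le_trans _ _ (\int[P]_t \int[P]_t' W xpredT (Z xpredT (t, t')))%E).
  apply: ge0_le_integral_nonmeas => [t _|t _]; first exact: supabs_ge0.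
  apply/ereal_supP => _ [_ [g Gg <-] <-].
  under eq_bigr do rewrite packK.
  exact: dev_le_ghost.
rewrite -(@fubini_tonelli1 _ _ _ _ _ P P (fun t => W xpredT (Z xpredT t)))//.
(* The joint law of sample and ghost is the same for every exchange pattern, so the pattern [s] may
   be inserted. *)
rewrite (iid_integral _ _ _ _ _ _ _ _ _ _ _ (iZ xpredT) (iZ s))//.
(* Exchanging the pairs selected by [s] amounts to changing signs of the differences; reversing all
   signs at once is absorbed by the absolute value. *)
rewrite (eq_integral (fun t => W s (Z xpredT t))); last first.
  move=> t _; congr ereal_sup; apply/seteqP; split => _ [_ [g Gg <-] <-].
    eexists; first by exists g.
    congr (`|_|%:E); apply: eq_bigr => i _.
    rewrite !packK !swap_samples_lshift !swap_samples_rshift /=.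
    by case: (s i); rewrite /sgn; ring.
  eexists; first by exists g.
  congr (`|_|%:E); apply: eq_bigr => i _.
  rewrite !packK !swap_samples_lshift !swap_samples_rshift /=.
  by case: (s i); rewrite /sgn; ring.
rewrite (@fubini_tonelli1 _ _ _ _ _ P P (fun t => W s (Z xpredT t)))//.
(* The signed differences split into the signed sum of the ghost and that of the sample, which have
   equal expectations: hence the factor 2. *)
apply: (@le_trans _ _ (\int[P]_t \int[P]_t' (V t' + V t))%E).
  apply: ge0_le_integral_nonmeas => [t _|t _]; first exact: integral_ge0.
  apply: ge0_le_integral_nonmeas => // t' _.
  apply/ereal_supP => _ [_ [g Gg <-] <-].
  rewrite (_ : \sum_(i < m) _ = \sum_(i < m) sgn (s i) * g (x i t') -
      \sum_(i < m) sgn (s i) * g (x i t)); last first.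
    rewrite -sumrB; apply: eq_bigr => i _.
    by rewrite !packK !swap_samples_lshift !swap_samples_rshift /= mulrBr.
  apply: le_trans (_ : (`|\sum_(i < m) sgn (s i) * g (x i t')| +
      `|\sum_(i < m) sgn (s i) * g (x i t)|)%:E <= _)%E.
    by rewrite lee_fin ler_normB.
  rewrite EFinD; apply: leeD; (apply: ereal_sup_ubound; eexists; first by exists g).
    by congr (`|_|%:E); apply: eq_bigr => i _; rewrite packK.
  by congr (`|_|%:E); apply: eq_bigr => i _; rewrite packK.
have mcst (r : \bar R) : measurable_fun [set: T] (fun=> r) by exact: measurable_cst.
have IV t : (\int[P]_t' (V t' + V t) = \int[P]_t' V t' + V t)%E.
  by rewrite (ge0_integralD P measurableT (fun t _ => V0 t) mV (fun _ _ => V0 t) (mcst _))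
    prob_integral_cst.
have I0 : (0 <= \int[P]_t V t)%E by exact: integral_ge0.
rewrite (eq_integral _ _ (fun t _ => IV t)).
rewrite (ge0_integralD P measurableT (fun _ _ => I0) (mcst _) (fun t _ => V0 t) mV).
by rewrite prob_integral_cst (_ : 2%:E = 1 + 1)%E// ge0_muleDl// !mul1e.
Qed.

End symmetrization.

(** * A strong law along squares *)

Section slln_squares.
Context {R : realType} d0 (T : measurableType d0) (P : probability T R).
Context (Y : nat -> T -> R) (C mu : R).
Context (mY : forall j, measurable_fun setT (Y j)).
Context (bY : forall j t, 0 <= Y j t <= C).
Context (EY : forall j, (\int[P]_t (Y j t)%:E = mu%:E)%E).
Context (EYY : forall i j, i != j -> (\int[P]_t (Y i t * Y j t)%:E = (mu ^+ 2)%:E)%E).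

Let C0 : 0 <= C.
Proof.
have [t _] : [set: T] !=set0.
  apply/set0P/eqP => T0; have := probability_setT P.
  by rewrite T0 measure0 => /eqP; rewrite eqe eq_sym oner_eq0.
by have /andP[] := bY 0 t; exact: le_trans.
Qed.

Let normY j t : `|Y j t| <= C.
Proof. by have /andP[? ?] := bY j t; rewrite ger0_norm. Qed.

Let mu0C : 0 <= mu <= C.
Proof.
apply/andP; split; rewrite -lee_fin -(EY 0).
  by apply: integral_ge0 => t _; rewrite lee_fin; case/andP: (bY 0 t).
rewrite -[leRHS](prob_integral_cst _ _ P); apply: ge0_le_integral_nonmeas => t _;
  by rewrite lee_fin; case/andP: (bY 0 t).
Qed.

Let mYmu j : measurable_fun setT (fun t => Y j t - mu).
Proof. by apply: measurable_funB. Qed.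

Let normYmu j t : `|Y j t - mu| <= C.
Proof.
have /andP[? ?] := bY j t; have /andP[? ?] := mu0C.
by rewrite ler_norml; apply/andP; split; lra.
Qed.

Let cov i j := (\int[P]_t ((Y i t - mu) * (Y j t - mu))%:E)%E.

Let mcov i j : measurable_fun setT (fun t => (Y i t - mu) * (Y j t - mu)).
Proof. by apply: measurable_funM; exact: mYmu. Qed.

Let icov i j : P.-integrable setT (fun t => ((Y i t - mu) * (Y j t - mu))%:E).
Proof.
apply: (bounded_integrable _ _ P _ (C * C) (mcov i j)) => t.
by rewrite normrM ler_pM// normYmu.
Qed.

Let cov_neq i j : i != j -> cov i j = 0%E.
Proof.
move=> ij; have iY k : P.-integrable setT (EFin \o (fun t => mu * Y k t)).
  apply: (bounded_integrable _ _ P _ (`|mu| * C)) => [|t].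
    exact: measurable_funM.
  by rewrite normrM ler_wpM2l.
have iYY : P.-integrable setT (EFin \o (fun t => Y i t * Y j t)).
  apply: (bounded_integrable _ _ P _ (C * C)) => [|t].
    exact: measurable_funM.
  by rewrite normrM ler_pM.
have i2 : P.-integrable setT (EFin \o (fun=> mu ^+ 2)).
  exact: (bounded_integrable _ _ P _ `|mu ^+ 2| (measurable_cst _)).
have EmY k : (\int[P]_t (mu * Y k t)%:E = (mu ^+ 2)%:E)%E.
  under eq_integral do rewrite EFinM.
  rewrite integralZl//; last exact: (bounded_integrable _ _ P _ C (mY k)).
  by rewrite EY -EFinM expr2.
rewrite /cov (eq_integral (fun t => (Y i t * Y j t)%:E - (mu * Y i t)%:E
    + ((mu ^+ 2)%:E - (mu * Y j t)%:E))%E); last first.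
  by move=> t _; rewrite -!EFinB -EFinD; congr EFin; ring.
have i1 := integrableB measurableT iYY (iY i).
have i3 := integrableB measurableT i2 (iY j).
apply: etrans (integralD measurableT i1 i3) _.
rewrite (integralB measurableT iYY (iY i)) (integralB measurableT i2 (iY j)).
rewrite [X in (_ + (X - _))%E]prob_integral_cst (EmY i) (EmY j).
rewrite [X in (X - _ + _)%E](EYY _ _ ij).
by rewrite -!EFinB -EFinD; congr EFin; ring.
Qed.

Let cov_diag i : (cov i i <= (C ^+ 2)%:E)%E.
Proof.
rewrite -[leRHS](prob_integral_cst _ _ P); apply: ge0_le_integral_nonmeas => t _.
  by rewrite lee_fin -expr2 sqr_ge0.
by rewrite lee_fin -expr2 -[X in X <= _]ger0_norm ?sqr_ge0// normrX lerXn2r ?nnegrE// normYmu.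
Qed.

Let Z k t := \sum_(j < k) (Y j t - mu).

Let mZ k : measurable_fun setT (Z k).
Proof. by apply: measurable_sum => j; exact: mYmu. Qed.

(** The variables are pairwise uncorrelated, so only the k diagonal covariances survive, each at
    most C^2. *)
Let second_moment k : (\int[P]_t (Z k t ^+ 2)%:E <= (k%:R * C ^+ 2)%:E)%E.
Proof.
rewrite (eq_integral (fun t => \sum_(i < k) \sum_(j < k)
    ((Y i t - mu) * (Y j t - mu))%:E)%E); last first.
  move=> t _; rewrite expr2 /Z mulr_suml -sumEFin; apply: eq_bigr => i _.
  by rewrite mulr_sumr sumEFin.
rewrite integral_sum//; last by move=> i; apply: integrable_sum => // j _; exact: icov.
apply: (@le_trans _ _ (\sum_(i < k) (C ^+ 2)%:E)%E); last first.
  by rewrite sumEFin sumr_const card_ord mulr_natl.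
apply: lee_sum => i _; rewrite integral_sum//.
rewrite (bigD1 i)//= big1 ?adde0 => [|j ji]; first exact: cov_diag.
by apply: cov_neq; rewrite eq_sym.
Qed.

Let avg l t := (Z (l.+1 ^ 2) t / (l.+1 ^ 2)%:R) ^+ 2.

Let mavg l : measurable_fun setT (avg l).
Proof. by apply: measurable_funX; apply: measurable_funM. Qed.

Let Eavg l : (\int[P]_t (avg l t)%:E <= (C ^+ 2 / l.+1%:R ^+ 2)%:E)%E.
Proof.
have n0 : (l.+1 ^ 2)%:R != 0 :> R by rewrite pnatr_eq0 expn_eq0.
under eq_integral do rewrite /avg expr_div_n mulrC EFinM.
rewrite ge0_integralZl//; last 2 first.
- by apply/measurable_EFinP; apply: measurable_funX.
- by move=> t _; rewrite lee_fin sqr_ge0.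
apply: (@le_trans _ _ (((l.+1 ^ 2)%:R ^- 2)%:E * ((l.+1 ^ 2)%:R * C ^+ 2)%:E)%E).
  by apply: lee_wpmul2l (second_moment _); rewrite lee_fin invr_ge0 sqr_ge0.
rewrite -EFinM lee_fin natrX in n0 *; rewrite le_eqVlt; apply/orP; left; apply/eqP.
by move: n0; move: (_ ^+ 2 : R) => z z0; field.
Qed.

(** Telescoping, from 1/(l+1)^2 <= 2/(l+1) - 2/(l+2). *)
Let sum_inv_sqr n : \sum_(l < n) (l.+1%:R ^+ 2)^-1 <= 2 - 2 / n.+1%:R :> R.
Proof.
elim: n => [|n IH]; first by rewrite big_ord0 divr1 subrr.
rewrite big_ord_recr/= (le_trans (lerD IH (lexx _)))// -subr_ge0.
have n1 : (0 : R) < n.+1%:R by [].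
rewrite (_ : _ - _ = n%:R / (n.+1%:R ^+ 2 * n.+2%:R)).
  by rewrite divr_ge0// mulr_ge0// sqr_ge0.
rewrite -[n.+2]addn2 -[n.+1]addn1 !natrD; field.
by rewrite !gt_eqF// ltr_wpDl.
Qed.

(** Along k = (l+1)^2 the squared centred average has expectation at most C^2/(l+1)^2, which is
    summable. The series of these squares is therefore integrable, almost surely finite, and its
    terms tend to 0. *)
Lemma slln_squares : {ae P, forall t, forall e : R, 0 < e ->
  \forall l \near \oo, \sum_(j < l.+1 ^ 2) Y j t <= (l.+1 ^ 2)%:R * (mu + e)}.
Proof.
have avg0 l t : (0 <= (avg l t)%:E)%E by rewrite lee_fin sqr_ge0.
have mEavg l : measurable_fun setT (fun t => (avg l t)%:E) by exact/measurable_EFinP.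
pose S t := (\sum_(l <oo) (avg l t)%:E)%E.
have S0 t : (0 <= S t)%E by exact: nneseries_ge0.
have IS : (\int[P]_t S t < +oo)%E.
  rewrite integral_nneseries//.
  apply: (@le_lt_trans _ _ (C ^+ 2 * 2)%:E); last exact: ltry.
  apply: lime_le; first by apply: is_cvg_nneseries => n _ _; exact: integral_ge0.
  apply: nearW => n; rewrite big_mkord.
  apply: (@le_trans _ _ (\sum_(l < n) (C ^+ 2 / l.+1%:R ^+ 2)%:E)%E).
    by apply: lee_sum => l _; exact: Eavg.
  rewrite sumEFin lee_fin -mulr_sumr ler_wpM2l ?sqr_ge0//.
  by apply: le_trans (sum_inv_sqr n) _; rewrite gerBl divr_ge0.
have mS : measurable_fun setT S by exact: ge0_emeasurable_sum.
have iS : P.-integrable setT S.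
  apply/integrableP; split => //.
  by under eq_integral do rewrite gee0_abs//.
have := integrable_ae measurableT iS.
apply: filterS => t /(_ I) Sfin e e0.
have Sty : (S t < +oo)%E by rewrite -ge0_fin_numE.
(* The tail of a convergent nonnegative series tends to 0 and dominates its first term; the
   threshold is [e ^+ 2] because [avg] is a square. *)
have /fine_cvgP[_ /cvgrPdist_lt] := nneseries_tail_cvg Sty (fun l _ => avg0 l t).
have e20 : 0 < e ^+ 2 by rewrite exprn_gt0.
move=> /(_ _ e20); apply: filterS => l /=.
rewrite sub0r normrN => lt_e.
have tl0 : (0 <= \sum_(l <= k <oo) (avg k t)%:E)%E by exact: nneseries_ge0.
have tlS : (\sum_(l <= k <oo) (avg k t)%:E <= S t)%E.
  rewrite /S (nneseries_split 0 l)//= add0n leeDr//.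
  by rewrite big_mkord sumEFin lee_fin sumr_ge0// => k _; exact: sqr_ge0.
have : ((avg l t)%:E < (e ^+ 2)%:E)%E.
  apply: (@le_lt_trans _ _ (\sum_(l <= k <oo) (avg k t)%:E)%E).
    have := @nneseries_lim_ge R (fun k => (avg k t)%:E) xpredT l l.+1.
    by rewrite big_nat1; apply => k _ _; exact: avg0.
  move: lt_e; rewrite ger0_norm; last exact: fine_ge0.
  rewrite -lte_fin fineK// ge0_fin_numE//; exact: le_lt_trans tlS Sty.
rewrite lte_fin /avg => lt2.
have n0 : (0 : R) < (l.+1 ^ 2)%:R by rewrite ltr0n expn_gt0.
have : Z (l.+1 ^ 2) t / (l.+1 ^ 2)%:R <= e.
  rewrite leNgt; apply/negP => /ltW eZ.
  by move: lt2; rewrite ltNge => /negP; apply; rewrite lerXn2r// ?nnegrE ?(le_trans _ eZ)// ltW.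
rewrite ler_pdivrMr// /Z sumrB sumr_const card_ord lerBlDr => h.
by apply: le_trans h _; rewrite -[mu *+ _]mulr_natl mulrDr addrC [_ * e]mulrC.
Qed.

End slln_squares.

(** * A one-sided uniform law of large numbers *)

Lemma sumr_nat_blocks {V : nmodType} n m (f : nat -> V) :
  \sum_(0 <= i < n * m) f i = \sum_(j < n) \sum_(i < m) f (j * m + i)%N.
Proof.
elim: n => [|n IH]; first by rewrite mul0n big_geq// big_ord0.
rewrite mulSn addnC (big_cat_nat (n := (n * m)%N))//=; last by rewrite leq_addr.
rewrite big_ord_recr/= IH; congr (_ + _).
rewrite -[X in \sum_(X <= _ < _) _]add0n big_addn addKn big_mkord.
by apply: eq_bigr => i _; rewrite addnC.
Qed.

(** The number of full blocks is rounded down to a perfect square, since the strong law is available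
    only along squares; [L.+2] in the hypothesis makes the root large enough. *)
Lemma between_squares L m M : (0 < m)%N -> (L.+2 ^ 2 * m <= M)%N ->
  exists l, [/\ (L <= l)%N, (l.+1 ^ 2 * m <= M)%N & (M < l.+2 ^ 2 * m)%N].
Proof.
move=> m0 LM.
have ex : exists k, (M < k ^ 2 * m)%N.
  by exists M.+1; rewrite -mulnn; nia.
case: (ex_minnP ex) => k Mk kmin.
have Lk : (L.+2 < k)%N.
  rewrite ltnNge; apply/negP => kL; have kL2 : (k ^ 2 <= L.+2 ^ 2)%N by rewrite leq_exp2r.
  by have := leq_trans Mk (leq_trans (leq_mul kL2 (leqnn m)) LM); rewrite ltnn.
case: k Mk kmin Lk => [|[|l]]// Mk kmin Lk; exists l; split => //.
  by rewrite !ltnS in Lk; exact: ltnW.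
rewrite leqNgt; apply/negP => /kmin; by rewrite ltnn.
Qed.

Section ulln.
Context {R : realType} (d : nat) (PO : probability 'rV[R]_d R).
Context (G : set ('rV[R]_d -> R)) (C : R).
Context (G0 : G !=set0).
Context (cG : forall g, G g -> continuous g).
Context (bG : forall g, G g -> forall w, 0 <= g w <= C).
Context d0 (T : measurableType d0) (P : probability T R) (omega : nat -> T -> 'rV[R]_d).
Context (iomega : forall m (e : 'I_m -> nat), injective e ->
  iid d PO d0 T P m (fun i => omega (e i))).
Context (m : nat).
Context (m0 : (0 < m)%N).

Let block j t := pack m d (fun i => omega (j * m + i)%N t).
Let S := supabs _ (dev_class d PO G m).

Let S0 w : (0 <= S w)%E.
Proof. by apply: supabs_ge0; case: G0 => g Gg; eexists; exists g. Qed.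

Let mS : measurable_fun [set: 'rV[R]_(m * d)] S.
Proof. by apply: measurable_supabs => h; exact: dev_class_continuous. Qed.

Let iblock j : iid d PO d0 T P m (fun i => omega (j * m + i)%N).
Proof. by apply: iomega => i i' /addnI /val_inj. Qed.

Let mblock j : measurable_fun setT (block j).
Proof. by apply: measurable_pack; exact: (iblock j).1. Qed.

Lemma mean_bounds g : G g -> 0 <= mean d PO g <= C.
Proof.
move=> Gg; have E := mean_sample d PO G C cG bG d0 T P m _ (iblock 0) g (Ordinal m0) Gg.
rewrite -!lee_fin -E -[(C%:E)](prob_integral_cst _ _ P); apply/andP; split.
  by apply: integral_ge0 => t _; rewrite lee_fin; case/andP: (bG g Gg (omega (0 * m + 0)%N t)).
by apply: ge0_le_integral_nonmeas => t _; rewrite lee_fin;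
  case/andP: (bG g Gg (omega (0 * m + 0)%N t)).
Qed.

Let SC w : (S w <= (m%:R * C)%:E)%E.
Proof.
apply/ereal_supP => _ [_ [g Gg <-] <-]; rewrite lee_fin.
apply: le_trans (ler_norm_sum _ _ _) _.
apply: (@le_trans _ _ (\sum_(i < m) C)); last by rewrite sumr_const card_ord mulr_natl.
apply: ler_sum => i _; have /andP[? ?] := mean_bounds g Gg.
have /andP[? ?] := bG g Gg (blk m d w i).
by rewrite ler_norml; apply/andP; split; lra.
Qed.

Let Sfin w : S w \is a fin_num.
Proof. by rewrite ge0_fin_numE// (le_lt_trans (SC w))// ltry. Qed.

Let ES := (\int[P]_t S (block 0 t))%E.

Let ESfin : ES \is a fin_num.
Proof.
rewrite ge0_fin_numE; last exact: integral_ge0.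
apply: le_lt_trans (ltry (m%:R * C)); rewrite -[leRHS](prob_integral_cst _ _ P).
exact: ge0_le_integral_nonmeas.
Qed.

Let ES_block j : (\int[P]_t S (block j t) = ES)%E.
Proof. exact: (iid_integral d PO _ _ _ _ P P m _ _ (iblock j) (iblock 0) S mS S0). Qed.

(** The concatenation of two disjoint blocks has the law of two independent copies of block 0 on the
    product space, where Tonelli factors the integral. *)
Let ES_pair j k : j != k -> (\int[P]_t (S (block j t) * S (block k t)) = ES * ES)%E.
Proof.
move=> jk; pose sel (e : 'I_m -> 'I_(m + m)) (w : 'rV[R]_((m + m) * d)) :=
  pack m d (fun i => blk (m + m) d w (e i)).
have msel e : measurable_fun [set: 'rV[R]_((m + m) * d)] (sel e).
  by apply: measurable_pack => i; exact: measurable_blk.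
pose h w := (S (sel (@lshift m m) w) * S (sel (@rshift m m) w))%E.
have mh : measurable_fun [set: 'rV[R]_((m + m) * d)] h.
  by apply: emeasurable_funM; exact: measurableT_comp mS (msel _).
have h0 w : (0 <= h w)%E by exact: mule_ge0.
(* Enumerates the indices of block [j], then those of block [k]. *)
pose e (q : 'I_(m + m)) : nat :=
  match fintype.split q with inl i => j * m + i | inr i => k * m + i end.
have sep (a b : 'I_m) : (j * m + a)%N <> (k * m + b)%N.
  move=> E; move/eqP: jk; apply; have := congr1 (divn^~ m) E.
  by rewrite /= !divnMDl// !divn_small// !addn0.
have inj_e : injective e.
  move=> q q'; rewrite /e -{2}[q]splitK -{2}[q']splitK.
  case: (fintype.split q) => a; case: (fintype.split q') => b.
  - by move/addnI/val_inj => ->.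
  - by move/sep.
  - by move/esym/sep.
  - by move/addnI/val_inj => ->.
have i1 := iomega _ _ inj_e.
have i2 := iid_swap d PO _ _ _ _ P P m _ _ xpredT (iblock 0) (iblock 0).
have := iid_integral d PO _ _ _ _ _ _ _ _ _ i1 i2 h mh h0.
rewrite (eq_integral (fun t => S (block j t) * S (block k t))%E); last first.
  move=> t _; congr (S _ * S _)%E; congr (pack _ _ _); apply/funext => i;
    rewrite packK /e.
    by rewrite (unsplitK (inl i)).
  by rewrite (unsplitK (inr i)).
move=> ->.
rewrite (eq_integral (fun t : T * T => S (block 0 t.1) * S (block 0 t.2))%E); last first.
  move=> t _; congr (S _ * S _)%E; congr (pack _ _ _); apply/funext => i;
    by rewrite packK ?swap_samples_lshift ?swap_samples_rshift.
have mSb : measurable_fun setT (fun t => S (block 0 t)) by exact: measurableT_comp mS (mblock 0).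
rewrite (@fubini_tonelli1 _ _ _ _ _ P P (fun t => S (block 0 t.1) * S (block 0 t.2)))%E//; last 2 first.
- apply: emeasurable_funM; [exact: measurableT_comp mSb measurable_fst|
    exact: measurableT_comp mSb measurable_snd].
- by move=> t; exact: mule_ge0.
rewrite /fubini_F/=.
under eq_integral do rewrite (ge0_integralZl P measurableT mSb (fun t _ => S0 _) (S0 _)).
have ES0 : (0 <= ES)%E by exact: integral_ge0.
exact: (ge0_integralZr P measurableT mSb (fun t _ => S0 _) ES0).
Qed.

(** Choose l with (l+1)^2 m <= M < (l+2)^2 m. The strong law controls the first (l+1)^2 block
    suprema; the leftover points number O(sqrt M) for fixed m and contribute at most C each. The
    null set depends neither on g nor on e. *)
Lemma ulln : {ae P, forall t, forall e : R, 0 < e -> \forall M \near \oo,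
  forall g, G g ->
    M%:R * mean d PO g <= \sum_(i < M) g (omega i t) + M%:R * (fine ES / m%:R + e)}.
Proof.
have m0R : (0 : R) < m%:R by rewrite ltr0n.
have C0 : 0 <= C.
  case: G0 => g Gg; have /andP[] := mean_bounds g Gg; exact: le_trans.
have ES0 : 0 <= fine ES by apply: fine_ge0; exact: integral_ge0.
have HY j t : 0 <= fine (S (block j t)) <= m%:R * C.
  by rewrite fine_ge0//= -lee_fin fineK.
have mY j : measurable_fun setT (fun t => fine (S (block j t))).
  have mSb : measurable_fun setT (S \o block j) by exact: measurableT_comp mS (mblock j).
  by apply: measurableT_comp mSb; exact: fine_measurable.
have EY j : (\int[P]_t (fine (S (block j t)))%:E = (fine ES)%:E)%E.
  by under eq_integral do rewrite fineK//; rewrite ES_block fineK.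
have EYY j k : j != k ->
    (\int[P]_t (fine (S (block j t)) * fine (S (block k t)))%:E = (fine ES ^+ 2)%:E)%E.
  move=> jk; under eq_integral do rewrite EFinM !fineK//.
  by rewrite ES_pair// expr2 EFinM fineK.
have := slln_squares _ _ P (fun j t => fine (S (block j t))) (m%:R * C) (fine ES) mY HY EY EYY.
apply: filterS => t SL e e0.
have e20 : 0 < e / 2 by rewrite divr_gt0.
have [L1 _ HL1] := SL _ e20.
(* This makes 3 C <= (l+1) e/2, so that the leftover 3 (l+1) m C is at most (l+1)^2 m e/2 <= M
   e/2. *)
pose L2 := Num.truncn (3 * C / (e / 2)).
pose L := maxn L1 L2.
exists (L.+2 ^ 2 * m)%N => // M /= LM g Gg.
have [l [Ll lM Ml]] := between_squares L m M m0 LM.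
have {HL1}Sl := HL1 l (leq_trans (leq_maxl _ _) Ll); rewrite /= in Sl.
have lbig : 3 * C <= l.+1%:R * (e / 2).
  rewrite -ler_pdivrMr//; apply: ltW; apply: lt_le_trans (truncnS_gt _) _.
  by rewrite ler_nat ltnS (leq_trans (leq_maxr L1 L2)).
have /andP[mean0 meanC] := mean_bounds g Gg.
have dev i : mean d PO g - g (omega i t) <= C.
  by have /andP[? ?] := bG g Gg (omega i t); lra.
have sumE : M%:R * mean d PO g - \sum_(i < M) g (omega i t) =
    \sum_(0 <= i < M) (mean d PO g - g (omega i t)).
  by rewrite big_mkord sumrB sumr_const card_ord mulr_natl.
rewrite -lerBlDl sumE (big_cat_nat (n := (l.+1 ^ 2 * m)%N))//= sumr_nat_blocks.
have blocks : \sum_(j < l.+1 ^ 2) \sum_(i < m) (mean d PO g - g (omega (j * m + i)%N t)) <=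
    (l.+1 ^ 2)%:R * (fine ES + e / 2).
  apply: le_trans Sl; apply: ler_sum => j _.
  apply: le_trans (ler_norm _) _; rewrite -lee_fin fineK//.
  apply: ereal_sup_ubound; eexists; first by exists g.
  by congr (`|_|%:E); apply: eq_bigr => i _; rewrite packK.
have rest : \sum_(l.+1 ^ 2 * m <= i < M) (mean d PO g - g (omega i t)) <=
    (M - l.+1 ^ 2 * m)%:R * C.
  apply: le_trans (ler_sum _ (fun i _ => dev i)) _.
  by rewrite big_const_nat iter_addr addr0 mulr_natl.
apply: le_trans (lerD blocks rest) _.
have lMR : (l.+1 ^ 2)%:R * m%:R <= M%:R :> R by rewrite -natrM ler_nat.
(* Consecutive squares differ by 2l+3 <= 3(l+1). *)
have gapN : (M - l.+1 ^ 2 * m <= 3 * l.+1 * m)%N.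
  rewrite leq_subLR -mulnDl; apply: leq_trans (ltnW Ml) _.
  rewrite leq_mul2r -!mulnn; apply/orP; right.
  clear -l; lia.
have gap : (M - l.+1 ^ 2 * m)%:R <= 3 * l.+1%:R * m%:R :> R.
  by have := gapN; rewrite -(ler_nat R) !natrM.
have lm0 : (0 : R) <= (l.+1 ^ 2)%:R by [].
have m1 : (1 : R) <= m%:R by rewrite ler1n.
(* The three summands absorb, in order, the expected block supremum, its fluctuation, and the
   leftover points. *)
rewrite mulrDr; apply: (@le_trans _ _ (M%:R * (fine ES / m%:R) + M%:R * (e / 2) + M%:R * (e / 2))).
  apply: lerD; first apply: lerD.
  - rewrite mulrA ler_pdivlMr// mulrAC; exact: ler_wpM2r.
  - apply: ler_wpM2r; first exact: ltW.
    by apply: le_trans lMR; rewrite ler_peMr.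
  - apply: le_trans (ler_wpM2r C0 gap) _.
    rewrite (_ : 3 * _ * _ * C = l.+1%:R * m%:R * (3 * C)); last by ring.
    apply: (@le_trans _ _ (l.+1%:R * m%:R * (l.+1%:R * (e / 2)))); first exact: ler_wpM2l.
    rewrite (_ : _ * _ * _ = (l.+1 ^ 2)%:R * m%:R * (e / 2)); last first.
      by rewrite -mulnn natrM; ring.
    by apply: ler_wpM2r lMR; exact: ltW.
by rewrite -!mulrDr -addrA -splitr.
Qed.

End ulln.

(** * Comparison of the expected deviation with the Rademacher complexity *)

Section rademacher_bound.
Context {R : realType} (d : nat) (PO : probability 'rV[R]_d R).
Context (G : set ('rV[R]_d -> R)) (C : R).
Context (G0 : G !=set0).
Context (cG : forall g, G g -> continuous g).
Context (bG : forall g, G g -> forall w, 0 <= g w <= C).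
Context d0 (T : measurableType d0) (P : probability T R) (omega : nat -> T -> 'rV[R]_d).
Context (iomega : forall m (e : 'I_m -> nat), injective e ->
  iid d PO d0 T P m (fun i => omega (e i))).
Context (H : set ('rV[R]_d -> R)) (Om : set 'rV[R]_d).
Context (mOm : measurable Om).
Context (aeOm : forall i, P (omega i @^-1` (~` Om)) = 0%E).
Context (GH : forall g, G g -> exists2 h, H h & forall w, Om w -> g w = h w).
Context (m : nat).
Context (m0 : (0 < m)%N).

Let bad := \bigcup_i (omega i @^-1` (~` Om)).

Let momega i : measurable_fun setT (omega i).
Proof.
have inj : injective (fun _ : 'I_1 => i) by move=> x y _; rewrite (ord1 x) (ord1 y).
exact: (iomega 1 _ inj).1 ord0.
Qed.

Let mpre i : measurable (omega i @^-1` (~` Om)).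
Proof. by rewrite -[X in measurable X]setTI; apply: momega => //; exact: measurableC. Qed.

Let mbad : measurable bad.
Proof. exact: bigcupT_measurable. Qed.

Let bad0 : P bad = 0%E.
Proof.
apply/measure_negligible => //; apply: negligible_bigcup => i.
by apply/negligibleP; [exact: mpre|exact: aeOm].
Qed.

Let x (i : 'I_m) := omega (0 * m + i)%N.

Let ix : iid d PO d0 T P m x.
Proof. by apply: iomega => i i' /addnI /val_inj. Qed.

Let rad (s : 'I_m -> bool) t :=
  ereal_sup [set (`| m%:R^-1 * \sum_(i < m) sgn (s i) * h (omega i t) |)%:E | h in H].

(** Almost surely all samples lie in [Om], where each member of [G] coincides with a member of [H].
    The factor m undoes the normalisation of [rad]. *)
Let rad_integral s :
  (\int[P]_t supabs _ (rad_class d G m s) (pack m d (x ^~ t)) <=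
   m%:R%:E * \int[P]_t rad s t)%E.
Proof.
pose V t := supabs _ (rad_class d G m s) (pack m d (x ^~ t)).
have mR : (0 : R) < m%:R by rewrite ltr0n.
have V0 t : (0 <= V t)%E.
  by apply: supabs_ge0; case: G0 => g Gg; eexists; exists g.
have mV : measurable_fun setT V.
  apply: measurableT_comp; last by apply: measurable_pack; exact: ix.1.
  by apply: measurable_supabs => g; exact: rad_class_continuous.
have rad0 t : (0 <= rad s t)%E.
  case: G0 => g /GH[h Hh _]; apply: le_ereal_sup_tmp.
  by exists (`| m%:R^-1 * \sum_(i < m) sgn (s i) * h (omega i t) |)%:E => //; exists h.
rewrite -lee_pdivrMl//.
(* The null set is removed from the integral of [V], whose measurability is known; the comparison
   with [rad] then needs monotonicity alone. *)
rewrite (ge0_negligible_integral mbad measurableT mV (fun t _ => V0 t) bad0).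
have mV' : measurable_fun (setT `\` bad) V by exact: measurable_funTS.
have m0i : (0 <= m%:R^-1 :> R) by rewrite invr_ge0 ltW.
rewrite -ge0_integralZl_EFin//; last exact: measurableD.
rewrite integral_mkcond; apply: ge0_le_integral_nonmeas => t _.
  by rewrite /patch; case: ifPn => // _; apply: mule_ge0.
rewrite /patch; case: ifPn => // tb; rewrite lee_pdivrMl//.
apply/ereal_supP => _ [_ [g Gg <-] <-]; have [h Hh gh] := GH g Gg.
apply: (@le_trans _ _ (m%:R%:E * (`| m%:R^-1 * \sum_(i < m) sgn (s i) * h (omega i t) |)%:E)%E).
  rewrite -EFinM lee_fin normrM gtr0_norm ?invr_gt0// mulrA divff ?gt_eqF// mul1r.
  rewrite le_eqVlt; apply/orP; left; apply/eqP; congr (`|_|); apply: eq_bigr => i _.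
  rewrite packK /x mul0n add0n gh//; apply: contrapT => nOm.
  by move: tb; rewrite inE => -[_]; apply; exists (i : nat).
by apply: lee_wpmul2l; [rewrite lee_fin ltW|apply: ereal_sup_ubound; exists h].
Qed.

(** Symmetrization bounds the same quantity for each of the 2^m sign vectors; averaging over them
    yields the Rademacher complexity. *)
Lemma dev_le_rademacher :
  (\int[P]_t supabs _ (dev_class d PO G m) (pack m d (x ^~ t)) <=
   (2 * m%:R)%:E * Rademacher d0 T P d omega H m)%E.
Proof.
set ES := (\int[P]_t _)%E.
have mR : (0 : R) < m%:R by rewrite ltr0n.
have rad0 s t : (0 <= rad s t)%E.
  case: G0 => g /GH[h Hh _]; apply: le_ereal_sup_tmp.
  by exists (`| m%:R^-1 * \sum_(i < m) sgn (s i) * h (omega i t) |)%:E => //; exists h.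
have step s : (ES <= (2 * m%:R)%:E * \int[P]_t rad s t)%E.
  apply: le_trans (symmetrization d PO G C G0 cG bG d0 T P m x ix s) _.
  by rewrite EFinM -muleA; apply: lee_wpmul2l.
have -> : (Rademacher d0 T P d omega H m =
    ((2 ^ m)%:R)^-1%:E * \sum_(s : {ffun 'I_m -> bool}) \int[P]_t rad s t)%E by [].
have n0 : (0 : R) < (2 ^ m)%:R by rewrite ltr0n expn_gt0.
rewrite muleCA lee_pdivlMl//.
have -> : ((2 ^ m)%:R%:E * ES = \sum_(s : {ffun 'I_m -> bool}) ES)%E.
  by rewrite sumr_const card_ffun card_bool card_ord mule_natl.
rewrite ge0_sume_distrr; last by move=> s _; exact: integral_ge0.
by apply: lee_sum => s _; exact: step.
Qed.

End rademacher_bound.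

(** * The Galerkin matrix and the H1 norm *)

Section poly_integral.
Context {R : realType}.
Local Notation leb := (@lebesgue_measure R).
Implicit Types p q : {poly R}.

Lemma measurable_I_int : @measurable _ (measurableTypeR R) (@I_int R).
Proof. exact: measurable_itv. Qed.

Lemma lebesgue_I_int : leb (@I_int R) = 2%:E.
Proof.
rewrite /I_int lebesgue_measure_itv/= lte_fin; case: ifPn => [_|].
  by rewrite -EFinD; congr EFin; ring.
by move/negP; case; lra.
Qed.

(** The sum of the absolute coefficients dominates the polynomial on (-1,1), where all powers of x
    are at most 1 in modulus. *)
Definition coef_norm p : R := \sum_(i < size p) `|p`_i|.

Lemma coef_norm_ge0 p : 0 <= coef_norm p.
Proof. exact: sumr_ge0. Qed.

Lemma horner_le_coef_norm p x : I_int x -> `|p.[x]| <= coef_norm p.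
Proof.
rewrite /I_int/= in_itv/= => /andP[x1 x2]; rewrite horner_coef.
apply: le_trans (ler_norm_sum _ _ _) _; apply: ler_sum => i _.
rewrite normrM normrX ler_piMr// exprn_ile1// ler_norml; apply/andP; split; exact: ltW.
Qed.

Lemma measurable_horner p : measurable_fun setT (horner p).
Proof. by apply: continuous_measurable_fun; exact: continuous_horner. Qed.

Lemma integrable_horner p : leb.-integrable I_int (EFin \o horner p).
Proof.
apply: measurable_bounded_integrable; first exact: measurable_I_int.
- by rewrite [X in (X < _)%E]lebesgue_I_int ltry.
- by apply: measurable_funTS; exact: measurable_horner.
- exists (coef_norm p); split; first exact: num_real.
  by move=> y py x Ix /=; apply: le_trans (horner_le_coef_norm p x Ix) (ltW py).
Qed.

Definition poly_int p : R := Rintegral leb I_int (fun x => p.[x]).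

Lemma poly_intD p q : poly_int (p + q) = poly_int p + poly_int q.
Proof.
rewrite /poly_int -RintegralD; [|exact: measurable_I_int|exact: integrable_horner..].
by apply: eq_Rintegral => x _; exact: hornerD.
Qed.

Lemma poly_intZ c p : poly_int (c *: p) = c * poly_int p.
Proof.
rewrite /poly_int -RintegralZl; [|exact: measurable_I_int|exact: integrable_horner].
by apply: eq_Rintegral => x _; exact: hornerZ.
Qed.

Lemma poly_int_sum n (c : 'I_n -> R) (p : 'I_n -> {poly R}) :
  poly_int (\sum_i c i *: p i) = \sum_i c i * poly_int (p i).
Proof.
elim/big_rec2: _ => [|i y1 y2 _ <-]; last by rewrite poly_intD poly_intZ.
by have := poly_intZ 0 0; rewrite scale0r mul0r.
Qed.

Lemma poly_int_sqr_ge0 p : 0 <= poly_int (p ^+ 2).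
Proof. by apply: Rintegral_ge0 => x _ /=; rewrite horner_exp sqr_ge0. Qed.

Lemma finite_roots p : p != 0 -> finite_set [set x | root p x].
Proof.
move=> p0; apply: contrapT => inf.
have [B BA sB] := infinite_set_fset (size p) inf.
have := max_poly_roots p0 (rs := finmap.enum_fset B) _ (finmap.fset_uniq B).
rewrite ltnNge sB => /(_ _)/negP; apply => //; apply/allP => x xB; exact: BA.
Qed.

(** Otherwise the null set off which the square vanishes, together with the finitely many roots of
    p, would cover an interval of length 2. *)
Lemma poly_int_sqr_eq0 p : poly_int (p ^+ 2) = 0 -> p = 0.
Proof.
move=> p0; apply/eqP/negPn/negP => pn0.
have Ep : (\int[leb]_(x in I_int) `|((p ^+ 2).[x])%:E| = 0)%E.
  transitivity (\int[leb]_(x in I_int) ((p ^+ 2).[x])%:E)%E.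
    by apply: eq_integral => x _; rewrite gee0_abs// lee_fin horner_exp sqr_ge0.
  rewrite -[LHS]fineK; first by congr EFin; exact: p0.
  by apply: integrable_fin_num; [exact: measurable_I_int|exact: integrable_horner].
have mp : measurable_fun I_int (fun x => ((p ^+ 2).[x])%:E).
  by apply: measurable_funTS; apply/measurable_EFinP; exact: measurable_horner.
have [N [mN N0 subN]] := (ae_eq_integral_abs leb measurable_I_int mp).1 Ep.
have rootN : leb [set x | root p x] = 0%E.
  by apply: countable_lebesgue_measure0; exact/finite_set_countable/finite_roots.
have mroot : measurable [set x | root p x].
  have := measurable_horner p measurableT [set 0] (measurable_set1 0); rewrite setTI.
  by congr (measurable _); apply/seteqP; split => x /= /rootP.
have : (leb I_int <= leb (N `|` [set x | root p x]))%E.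
  apply: le_measure; rewrite ?inE; [exact: measurable_I_int|exact: measurableU|].
  move=> x Ix; have [rx|rx] := boolP (root p x); [by right|left].
  apply: subN => /= /(_ Ix)[]; rewrite horner_exp => /eqP.
  by rewrite sqrf_eq0; apply/negP.
rewrite lebesgue_I_int; apply/negP; rewrite -ltNge.
apply: le_lt_trans (_ : _ <= leb N + leb [set x | root p x])%E _; first exact: measureU2.
by rewrite N0 rootN adde0.
Qed.

End poly_integral.

(** * The Legendre basis and invertibility of the Galerkin matrix *)

Section basis.
Context {R : realType}.

Let size_rodrigues k : size (('X ^+ 2 - 1 : {poly R}) ^+ k) = (k + k).+1.
Proof.
have sX : size ('X ^+ 2 - 1 : {poly R}) = 3 by rewrite -polyC1 size_XnsubC.
have := size_exp ('X ^+ 2 - 1 : {poly R}) k; rewrite sX /= mul2n -addnn => <-.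
rewrite prednK// lt0n size_poly_eq0 expf_neq0// -size_poly_eq0 sX//.
Qed.

Lemma legendre_coef_gt k j : (k < j)%N -> (legendre k : {poly R})`_j = 0.
Proof.
move=> kj; rewrite /legendre coefZ coef_derivn nth_default ?mul0rn ?mulr0//.
by rewrite size_rodrigues ltn_add2l.
Qed.

Lemma legendre_coef k : (legendre k : {poly R})`_k != 0.
Proof.
rewrite /legendre coefZ coef_derivn mulf_neq0//.
have : lead_coef (('X ^+ 2 - 1 : {poly R}) ^+ k) = 1.
  by apply/monicP/monic_exp; rewrite -polyC1 monicXnsubC.
rewrite lead_coefE size_rodrigues /= => ->.
by rewrite pnatr_eq0 -lt0n ffact_gt0 leq_addr.
Qed.

Lemma bcoef_neq0 bc k : (0 < k)%N -> bcoef bc k != 0 :> R.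
Proof.
case: bc => k0; rewrite /bcoef ?oppr_eq0 ?oner_eq0//.
by rewrite mulf_neq0 ?invr_eq0// pnatr_eq0 -lt0n muln_gt0 ?k0.
Qed.

Let phi_coefE bc k j : (phi bc k : {poly R})`_j =
  (legendre k : {poly R})`_j + acoef bc k * (legendre k.+1 : {poly R})`_j
  + bcoef bc k * (legendre k.+2 : {poly R})`_j.
Proof. by rewrite /phi !coefD (coefZ (acoef bc k)) (coefZ (bcoef bc k)). Qed.

Lemma phi_coef_gt bc k j : (k.+2 < j)%N -> (phi bc k : {poly R})`_j = 0.
Proof.
move=> kj; rewrite phi_coefE !legendre_coef_gt ?mulr0 ?addr0//; lia.
Qed.

Lemma phi_coef bc k : (0 < k)%N -> (phi bc k : {poly R})`_k.+2 != 0.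
Proof.
move=> k0; rewrite phi_coefE [X in X + _ + _]legendre_coef_gt//.
by rewrite mul0r !add0r mulf_neq0 ?bcoef_neq0 ?legendre_coef.
Qed.

(** For k > 0, [phi bc k] has degree exactly k+2, so the derivatives have distinct degrees.
    Descending induction on i: in the coefficient of X^(i+2), larger indices vanish by induction and
    smaller ones by degree. *)
Lemma deriv_phi_free bc n (u : 'I_n -> R) :
  \sum_i u i *: (phi bc i.+1)^`() = 0 -> forall i, u i = 0.
Proof.
move=> u0; suff H k (i : 'I_n) : (n <= i + k)%N -> u i = 0.
  by move=> i; apply: (H n); rewrite leq_addl.
elim: k i => [|k IH] i ik; first by move: (ltn_ord i); rewrite ltnNge -[X in (_ <= X)%N]addn0 ik.
have := congr1 (fun p : {poly R} => p`_i.+2) u0.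
rewrite coef0 coef_sum (bigD1 i)//= big1 => [|j ji].
  rewrite addr0 coefZ coef_deriv => /eqP.
  by rewrite mulf_eq0 mulrn_eq0/= (negbTE (phi_coef bc i.+1 _))// orbF => /eqP.
rewrite coefZ coef_deriv; have [ij|ij|ij] := ltngtP i j.
- by rewrite IH ?mul0r//; lia.
- by rewrite phi_coef_gt ?mul0rn ?mulr0.
- by move/eqP: ji; case; apply: val_inj.
Qed.

Lemma AbcE bc N (nu : R) i j : Abc bc N nu i j =
  poly_int ((phi bc i.+1)^`() * (phi bc j.+1)^`()) + nu * poly_int (phi bc i.+1 * phi bc j.+1).
Proof.
rewrite !mxE /poly_int; congr (_ + _ * _);
  by apply: eq_Rintegral => x _; rewrite hornerM.
Qed.

(** If u A = 0, pairing with u gives a zero sum of the integral of q1^2 and nu times that of q0^2.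
    As nu >= 0, q1 = 0, and independence of the derivatives gives u = 0; this covers nu = 0 for both
    boundary conditions. *)
Lemma Abc_unit bc N (nu : R) : 0 <= nu -> Abc bc N nu \in unitmx.
Proof.
move=> nu0; rewrite -row_free_unit -kermx_eq0; apply/rowV0P => u /sub_kermxP uA.
pose q1 := \sum_(i < N.-1) u ord0 i *: (phi bc i.+1)^`() : {poly R}.
pose q0 := \sum_(i < N.-1) u ord0 i *: phi bc i.+1 : {poly R}.
(* The quadratic form of a Gram matrix is the integral of a square; it serves for the stiffness and
   the mass part. *)
have prodE (p : 'I_N.-1 -> {poly R}) :
    \sum_j (\sum_i u ord0 i * poly_int (p i * p j)) * u ord0 j =
    poly_int ((\sum_i u ord0 i *: p i) ^+ 2).
  rewrite expr2 [in RHS]mulr_sumr.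
  under [in RHS]eq_bigr do rewrite -scalerAr.
  rewrite poly_int_sum; apply: eq_bigr => j _; rewrite mulrC; congr (_ * _).
  rewrite mulr_suml -poly_int_sum; congr poly_int; apply: eq_bigr => i _.
  by rewrite scalerAl.
have H : poly_int (q1 ^+ 2) + nu * poly_int (q0 ^+ 2) = 0.
  rewrite -(prodE (fun i => (phi bc i.+1)^`())) -(prodE (fun i => phi bc i.+1)).
  rewrite mulr_sumr -big_split/= big1// => j _.
  have := congr1 (fun v : 'rV[R]_N.-1 => v ord0 j) uA.
  rewrite !mxE => uAj; rewrite mulrA -mulrDl mulr_sumr -big_split/=.
  rewrite [X in X * _](_ : _ = 0) ?mul0r// -[RHS]uAj; apply: eq_bigr => i _.
  by rewrite AbcE; ring.
have q10 : q1 = 0.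
  apply: poly_int_sqr_eq0; apply/eqP; rewrite eq_le poly_int_sqr_ge0 andbT -H lerDl.
  by rewrite mulr_ge0// poly_int_sqr_ge0.
by apply/rowP => i; rewrite mxE; exact: (deriv_phi_free bc N.-1 (fun i => u ord0 i) q10).
Qed.

Lemma sqn_ge0 n (v : 'cV[R]_n) : 0 <= sqn n v.
Proof. by apply: sumr_ge0 => i _; rewrite sqr_ge0. Qed.

Lemma le_coord_eucl n (v : 'cV[R]_n) i : `|v i ord0| <= eucl n v.
Proof.
rewrite /eucl -sqrtr_sqr ler_wsqrtr// /sqn (bigD1 i)//= lerDl sumr_ge0// => j _.
exact: sqr_ge0.
Qed.

Lemma sqr_eucl n (v : 'cV[R]_n) : eucl n v ^+ 2 = sqn n v.
Proof. by rewrite sqr_sqrtr// sqn_ge0. Qed.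

Lemma sqr_sum_le n (c K : 'I_n -> R) (e : R) : (forall i, `|c i| <= e) ->
  (\sum_i c i * K i) ^+ 2 <= (\sum_i `|K i|) ^+ 2 * e ^+ 2.
Proof.
move=> ce; rewrite -exprMn -[leLHS]ger0_norm ?sqr_ge0// normrX lerXn2r ?nnegrE//.
  (* The bound must be nonnegative: for n > 0 this follows from [ce], while for n = 0 the sum is
     empty and [e] is unconstrained. *)
  case: n c K ce => [c K _|n c K ce]; first by rewrite !big_ord0 mul0r.
  by rewrite mulr_ge0 ?sumr_ge0// (le_trans _ (ce ord0)).
rewrite mulr_suml; apply: le_trans (ler_norm_sum _ _ _) _; apply: ler_sum => i _.
by rewrite normrM mulrC ler_wpM2l.
Qed.

Lemma sqn_mulmx_le m n (B : 'M[R]_(m, n)) : exists2 K, 0 <= K &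
  forall v, sqn m (B *m v) <= K * sqn n v.
Proof.
exists (\sum_i (\sum_j `|B i j|) ^+ 2); first by apply: sumr_ge0 => i _; rewrite sqr_ge0.
move=> v; rewrite mulr_suml; apply: ler_sum => i _; rewrite mxE -sqr_eucl.
under eq_bigr do rewrite mulrC.
exact: (sqr_sum_le n (fun j => v j ord0) (B i) _ (fun j => le_coord_eucl n v j)).
Qed.

Lemma H1sq_le bc N : exists2 K, 0 <= K &
  forall c : 'cV[R]_N.-1, (H1sq (upoly bc N c) <= (K * sqn N.-1 c)%:E)%E.
Proof.
pose k0 := (\sum_(i < N.-1) `|coef_norm (phi bc i.+1 : {poly R})|) ^+ 2.
pose k1 := (\sum_(i < N.-1) `|coef_norm ((phi bc i.+1 : {poly R})^`())|) ^+ 2.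
(* The factor 2 is the length of the interval. *)
exists ((k0 + k1) * 2); first by rewrite mulr_ge0// addr_ge0// sqr_ge0.
move=> c.
have bound (p : 'I_N.-1 -> {poly R}) x : I_int x ->
    (\sum_i c i ord0 *: p i).[x] ^+ 2 <= (\sum_i `|coef_norm (p i)|) ^+ 2 * sqn N.-1 c.
  move=> Ix; rewrite horner_sum -sqr_eucl.
  under eq_bigr do rewrite hornerZ.
  apply: le_trans (sqr_sum_le _ _ (fun i => (p i).[x]) _ (le_coord_eucl _ c)) _.
  rewrite ler_wpM2r ?sqr_ge0// lerXn2r ?nnegrE ?sumr_ge0// ler_sum// => i _.
  by rewrite (le_trans (horner_le_coef_norm _ x Ix))// ler_norm.
rewrite /H1sq (@le_trans _ _ (\int[lebesgue_measure]_(x in I_int) ((k0 + k1) * sqn N.-1 c)%:E)%E)//.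
  apply: ge0_le_integral_nonmeas => x Ix; first by rewrite lee_fin addr_ge0// sqr_ge0.
  rewrite lee_fin mulrDl lerD//; first exact: bound.
  by rewrite /upoly raddf_sum/=; under eq_bigr do rewrite derivZ; exact: bound.
have -> := integral_cst (@lebesgue_measure R) measurable_I_int ((k0 + k1) * sqn N.-1 c)%:E.
by rewrite [X in (_ * X)%E]lebesgue_I_int -EFinM lee_fin mulrAC.
Qed.

End basis.

(** * Continuity of the load vector *)

Lemma clamp_lipschitz {R : realType} (a b x y : R) :
  `|Num.max a (Num.min b x) - Num.max a (Num.min b y)| <= `|x - y|.
Proof.
rewrite /Num.max /Num.min.
have := ler_norm (x - y); have := ler_norm (y - x); rewrite (distrC y x).
move=> r1 r2; rewrite ler_norml.
by case: (ltP b x) => ?; case: (ltP b y) => ?; do ?case: ltP => ?;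
  apply/andP; split; lra.
Qed.

Section clamp.
Context {R : realType} (d : nat) (a b : R) (ab : a < b).

(** Projection onto the cube. The load vector is controlled only on [Omega]; composed with [clamp]
    it becomes continuous on the whole space without changing on [Omega]. *)
Definition clamp (w : 'rV[R]_d) : 'rV[R]_d :=
  \row_i Num.max a (Num.min b (w ord0 i)).

Lemma clamp_Omega w : Omega d a b (clamp w).
Proof.
move=> i; rewrite mxE le_max lexx/= ge_max (ltW ab)/=.
by rewrite ge_min lexx.
Qed.

Lemma clamp_id w : Omega d a b w -> clamp w = w.
Proof.
move=> Ow; apply/rowP => i; rewrite mxE; have /andP[aw wb] := Ow i.
by rewrite (min_r wb) (max_r aw).
Qed.

Lemma clamp_continuous : continuous clamp.
Proof.
move=> w A /nbhs_ballP[e /= e0 eA]; apply/nbhs_ballP; exists e => //= w' [_ bw].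
apply: eA; split => // k j; rewrite !mxE; have := bw k j; rewrite ord1 /ball/=.
exact/le_lt_trans/clamp_lipschitz.
Qed.

Lemma compact_Omega : compact (Omega d a b).
Proof.
have := @rV_compact R d (fun=> `[a, b]%classic) (fun=> @segment_compact _ a b).
by congr compact; apply/seteqP; split => w /= h i; have := h i; rewrite in_itv.
Qed.

Lemma measurable_Omega : measurable (Omega d a b).
Proof.
rewrite (_ : Omega d a b = box d (fun=> `[a, b]%classic)).
  by apply: measurable_box => i; exact: measurable_itv.
by apply/seteqP; split => w /= h i; have := h i; rewrite /= in_itv.
Qed.

End clamp.

Lemma continuous_cV {R : realType} (X : topologicalType) n (f : X -> 'cV[R]_n) :
  (forall i, continuous (fun x => f x i ord0)) -> continuous f.
Proof.
move=> cf x A [P Px PA]; have : \forall y \near x, forall i, P i ord0 (f y i ord0).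
  by apply: filter_forall => i; exact: cf i x _ (Px i ord0).
by apply: filterS => y Py; apply: PA => i j; rewrite ord1.
Qed.

Section Fvec_continuity.
Context {R : realType} (d N : nat) (a b : R) (ab : a < b) (bc : BC).
Context (f : 'rV[R]_d -> R -> R).
Local Notation leb := (@lebesgue_measure R).
Context (hfL1 : forall w, Omega d a b w ->
     leb.-integrable I_int (fun x => (f w x)%:E)).
Context (hfC : forall w0, Omega d a b w0 -> forall eps : R, 0 < eps ->
     exists2 delta : R, 0 < delta & forall w, Omega d a b w -> `|w - w0| < delta ->
       (\int[leb]_(x in I_int) (`|f w x - f w0 x|)%:E < eps%:E)%E).

Lemma integrable_mul_horner (h : R -> R) (p : {poly R}) :
  leb.-integrable I_int (EFin \o h) ->
  leb.-integrable I_int (EFin \o (fun x => h x * p.[x])).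
Proof.
move=> ih; suff : leb.-integrable I_int ((EFin \o h) \* (EFin \o horner p))%E by [].
apply: integrableMl; [exact: measurable_I_int|exact: ih| |].
  by apply: measurable_funTS; exact: measurable_horner.
exists (coef_norm p); split; first exact: num_real.
by move=> y py x Ix /=; apply: le_trans (horner_le_coef_norm p x Ix) (ltW py).
Qed.

Lemma Fvec_dist w w0 j : Omega d a b w -> Omega d a b w0 ->
  ((`|Fvec bc N d f w j ord0 - Fvec bc N d f w0 j ord0|)%:E <=
   (coef_norm (phi bc j.+1))%:E *
     \int[leb]_(x in I_int) (`|f w x - f w0 x|)%:E)%E.
Proof.
move=> Ow Ow0; set p := phi bc j.+1.
have i1 := integrable_mul_horner (f w) p (hfL1 w Ow).
have i0 := integrable_mul_horner (f w0) p (hfL1 w0 Ow0).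
have iB : leb.-integrable I_int (EFin \o (fun x => f w x - f w0 x)).
  suff : leb.-integrable I_int ((fun x => (f w x)%:E) \- (fun x => (f w0 x)%:E))%E by [].
  by apply: integrableB; [exact: measurable_I_int|exact: hfL1..].
rewrite !mxE -(RintegralB measurable_I_int i1 i0).
have iD := integrable_mul_horner _ p iB.
have E : Rintegral leb I_int (fun x => f w x * p.[x] - f w0 x * p.[x]) =
    Rintegral leb I_int (fun x => (f w x - f w0 x) * p.[x]).
  by apply: eq_Rintegral => x _; rewrite mulrBl.
rewrite [X in `|X|]E (EFin_normr_Rintegral measurable_I_int iD).
apply: le_trans (le_abse_integral _ measurable_I_int (measurable_int _ iD)) _.
rewrite -(@ge0_integralZl_EFin _ _ _ leb _ measurable_I_int
  (fun x => (`|f w x - f w0 x|)%:E))//; last 2 first.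
- have /measurable_EFinP mB := measurable_int _ iB.
  by apply/measurable_EFinP; exact: measurableT_comp mB.
- exact: coef_norm_ge0.
apply: ge0_le_integral_nonmeas => x Ix; first exact: abse_ge0.
rewrite -EFinM lee_fin normrM mulrC ler_wpM2r//; exact: horner_le_coef_norm.
Qed.

Lemma Fvec_clamp_continuous j :
  continuous (fun w => Fvec bc N d f (clamp d a b w) j ord0).
Proof.
move=> w A /nbhs_ballP[e /= e0 eA].
(* Adding 1 keeps the divisor positive. *)
pose K := coef_norm (phi bc j.+1 : {poly R}) + 1.
have K0 : 0 < K by rewrite ltr_wpDl// coef_norm_ge0.
have Ow := clamp_Omega d a b ab w.
have [delta delta0 hd] := hfC _ Ow (e / K) (divr_gt0 e0 K0).
have : \forall w' \near w, ball (clamp d a b w) delta (clamp d a b w').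
  by apply: clamp_continuous; exact: nbhsx_ballx.
apply: filterS => w' Bw'; apply: eA; move: Bw'.
rewrite mx_norm_ball /ball_/= distrC => /(hd _ (clamp_Omega d a b ab w')) H.
rewrite /ball/= distrC -lte_fin; apply: le_lt_trans (Fvec_dist _ _ _ _ _) _; [exact: clamp_Omega..|].
apply: (@le_lt_trans _ _ (K%:E * \int[leb]_(x in I_int)
    (`|f (clamp d a b w') x - f (clamp d a b w) x|)%:E)%E).
  by rewrite lee_wpmul2r ?integral_ge0// lee_fin lerDl.
apply: lt_le_trans (_ : (K%:E * (e / K)%:E) <= _)%E; last first.
  by rewrite -EFinM mulrCA divff ?mulr1// gt_eqF.
by rewrite lte_pmul2l.
Qed.

End Fvec_continuity.

(** Only x is confined to the compact interval; y may leave it, as the output of an approximating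
    network can. *)
Lemma compact_unif_continuous {R : realType} (s : R -> R) (B : R) : continuous s ->
  forall e, 0 < e -> exists2 delta, 0 < delta &
    forall x y, `|x| <= B -> `|y - x| < delta -> `|s y - s x| < e.
Proof.
move=> cs e e0.
pose Q delta x := forall y, `|y - x| < delta -> `|s y - s x| < e.
have cover x : `[- B, B]%classic x -> \forall x' \near x & i \near 0^'+, Q i x'.
  move=> _; have e2 : 0 < e / 2 by rewrite divr_gt0.
  have [delta /= delta0 hd] : \forall z \near x, ball (s x) (e / 2) (s z).
    by apply: cs; exact: nbhsx_ballx.
  have d2 : 0 < delta / 2 by rewrite divr_gt0.
  exists (ball x (delta / 2), [set i | i < delta / 2]) => /=.
    by split; [exact: nbhsx_ballx|exact: nbhs_right_lt].
  move=> [x' i] /= [xx' id] y yx'; rewrite /ball/= in xx' hd.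
  have sx' := hd x' (lt_trans xx' _); have sy := hd y.
  have {}sx' : `|s x - s x'| < e / 2 by apply: sx'; lra.
  have {}sy : `|s x - s y| < e / 2.
    apply: sy; rewrite /ball_/= (_ : x - y = (x - x') + (x' - y)); last by ring.
    by apply: le_lt_trans (ler_normD _ _) _; rewrite (distrC x' y); lra.
  rewrite (_ : s y - s x' = (s x - s x') - (s x - s y)); last by ring.
  by apply: le_lt_trans (ler_normB _ _) _; lra.
have H : \forall delta \near 0^'+, `[- B, B] `<=` Q delta.
  by apply: ((compact_near_coveringP _).1 (@segment_compact R (- B) B)).
have [delta [Qd d0]] := filter_ex (filterI H (nbhs_right_gt 0)).
exists delta => // x y xB; apply: Qd.
by rewrite /= in_itv/= -ler_norml.
Qed.

(** * Approximation by networks *)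

Lemma compact_bounded_fun {R : realType} (X : topologicalType) (K : set X) (f : X -> R) :
  compact K -> continuous f -> exists2 B, 0 <= B & forall w, K w -> `|f w| <= B.
Proof.
move=> cK cf; have [K0|/nonemptyPn K0] := pselect (K !=set0); last first.
  by exists 0 => // w; rewrite K0.
have cnf : {within K, continuous (fun w => `|f w|)}.
  by apply: continuous_subspaceT => w; apply: continuous_comp; [exact: cf|exact: norm_continuous].
have [c _ cmax] := compact_EVT_max K0 cK cnf.
by exists `|f c| => // w Kw; apply: cmax; rewrite inE.
Qed.

Section network.
Context {R : realType} (sigma sinv : R -> R).
Context (csig : continuous sigma).
Context (sig_bd : exists B : R, forall x, `|sigma x| <= B).
Context (sigK : forall x, sinv (sigma x) = x).
Context (csinv : {within range sigma, continuous sinv}).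
Local Notation sp := (sigma_plus sigma).
Local Notation sm := (sigma_minus sigma).

Let sup_sig : has_sup (range sigma).
Proof.
have [B sB] := sig_bd; split; first by exists (sigma 0); exists 0.
by exists B => _ [x _ <-]; exact: le_trans (ler_norm _) (sB x).
Qed.

Let inf_sig : has_inf (range sigma).
Proof.
have [B sB] := sig_bd; split; first by exists (sigma 0); exists 0.
by exists (- B) => _ [x _ <-]; have := sB x; rewrite ler_norml => /andP[].
Qed.

Let le_sp x : sigma x <= sp.
Proof. by apply: sup_ubound; [exact: sup_sig.2|exists x]. Qed.

Let sm_le x : sm <= sigma x.
Proof. by apply: inf_lbound; [exact: inf_sig.2|exists x]. Qed.

Let sm_lt_sp : sm < sp.
Proof.
rewrite lt_neqAle (le_trans (sm_le 0) (le_sp 0)) andbT; apply/eqP => E.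
have sE x : sigma x = sm by apply/le_anti; rewrite sm_le E le_sp.
have := sigK 0; rewrite sE -(sE 1) sigK => /eqP; by rewrite oner_eq0.
Qed.

Lemma haff_sigma_le C x : 0 <= C -> `|haff C sigma (sigma x)| <= C.
Proof.
move=> C0; have D : 0 < sp - sm by rewrite subr_gt0.
have r0 : 0 <= (sigma x - sm) / (sp - sm) by rewrite divr_ge0 ?subr_ge0// ltW.
have r1 : (sigma x - sm) / (sp - sm) <= 1.
  by rewrite ler_pdivrMr// mul1r lerD2r.
rewrite /haff -mulrA; move: (_ / _) r0 r1 => r r0 r1.
by rewrite ler_norml; apply/andP; split; nra.
Qed.

Lemma haff_sub C x y : haff C sigma x - haff C sigma y = 2 * C / (sp - sm) * (x - y).
Proof. by rewrite /haff; ring. Qed.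

Definition hinv C z := sm + (z + C) * (sp - sm) / (2 * C).

Lemma hinvK C z : 0 < C -> haff C sigma (hinv C z) = z.
Proof.
move=> C0; have D : sp - sm != 0 by rewrite gt_eqF// subr_gt0.
by rewrite /haff /hinv; field; rewrite D gt_eqF.
Qed.

(** The strict bound places [hinv C z] strictly between the infimum and the supremum of [sigma],
    hence between two attained values, and the intermediate value theorem applies. *)
Lemma hinv_range C z : `|z| < C -> range sigma (hinv C z).
Proof.
move=> zC; have C0 : 0 < C by exact: le_lt_trans zC.
have D : 0 < sp - sm by rewrite subr_gt0.
move: zC; rewrite ltr_norml => /andP[z1 z2].
have r0 : 0 < (z + C) / (2 * C) by rewrite divr_gt0 ?mulr_gt0//; lra.
have r1 : (z + C) / (2 * C) < 1 by rewrite ltr_pdivrMr ?mulr_gt0//; lra.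
have hE : hinv C z = sm + (z + C) / (2 * C) * (sp - sm) by rewrite /hinv; ring.
have lo : sm < hinv C z by rewrite hE ltrDl mulr_gt0.
have hi : hinv C z < sp by rewrite hE -ltrBrDl gtr_pMl.
have [_ [x1 _ <-] l1] := inf_lt inf_sig.1 lo.
have [_ [x2 _ <-] l2] := sup_gt sup_sig.1 hi.
have mm : Num.min (sigma x1) (sigma x2) <= hinv C z <= Num.max (sigma x1) (sigma x2).
  by rewrite ge_min (ltW l1) le_max (ltW l2) orbT.
have [x12|/ltW x21] := lerP x1 x2.
  have [c _ <-] := @IVT _ sigma _ _ _ x12 (continuous_subspaceT csig) mm.
  by exists c.
rewrite minC maxC in mm.
have [c _ <-] := @IVT _ sigma _ _ _ x21 (continuous_subspaceT csig) mm.
by exists c.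
Qed.

(** The target is pulled back through the output layer to the continuous map [G], which the classes
    [NNstar] approximate; uniform continuity of [sigma] on a bounded range and the slope of [haff]
    push the error forward. *)
Lemma NN_approx d m C (NNstar : nat -> set ('rV[R]_d -> 'cV[R]_m))
    (hUAP : forall K : set 'rV[R]_d, compact K ->
     forall g : 'rV[R]_d -> 'cV[R]_m, {within K, continuous g} ->
     forall eps : R, 0 < eps -> \forall n \near \oo,
       exists2 gh, NNstar n gh & forall x, K x -> `|gh x - g x| < eps)
    (K : set 'rV[R]_d) (target : 'rV[R]_d -> 'cV[R]_m) : compact K -> 0 < C ->
  (forall i, continuous (fun w => target w i ord0)) ->
  (forall w i, `|target w i ord0| < C) ->
  forall eta, 0 < eta -> \forall n \near \oo,
    exists2 alpha, NNclass d m C sigma NNstar n alpha &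
      forall w, K w -> forall i, `|alpha w i ord0 - target w i ord0| <= eta.
Proof.
move=> cK C0 ct tC eta eta0.
have D : 0 < sp - sm by rewrite subr_gt0.
pose G w : 'cV[R]_m := \col_i sinv (hinv C (target w i ord0)).
have cG i : continuous (fun w => G w i ord0).
  move=> w V; rewrite mxE => VG.
  (* [sinv] is continuous only within the range of [sigma], which its argument never leaves. *)
  have := (subspace_continuousP _ _).1 csinv _ (hinv_range C _ (tC w i)) V VG.
  have cu : continuous (fun w => hinv C (target w i ord0)).
    rewrite (_ : (fun w => _) =
        (fun w => (target w i ord0 - (- C)) * ((sp - sm) / (2 * C)) - (- sm))); last first.
      by apply/funext => w'; rewrite /hinv !opprK mulrA addrC.
    apply: fun_subr_continuous; last exact: cst_continuous.
    apply: fun_mulr_continuous; last exact: cst_continuous.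
    by apply: fun_subr_continuous; [exact: ct|exact: cst_continuous].
  move=> /cu nV; suff : \forall w' \near w, V (G w' i ord0) by [].
  move: nV; rewrite /= nbhs_simpl => nV.
  near=> w'; rewrite mxE; near: w'.
  apply: (filterS _ (nV : \forall w' \near w, range sigma (hinv C (target w' i ord0)) ->
    V (sinv (hinv C (target w' i ord0))))) => w' H.
  by apply: H; exact: hinv_range.
have sigG w i : haff C sigma (sigma (G w i ord0)) = target w i ord0.
  rewrite mxE; have [x _ hx] := hinv_range C _ (tC w i).
  by rewrite -hx sigK hx hinvK.
have cGs : continuous (fun w => \sum_i `|G w i ord0|).
  apply: sum_continuous => i w; apply: continuous_comp; [exact: cG|exact: norm_continuous].
have [B B0 GB] := compact_bounded_fun _ _ _ cK cGs.
pose L := 2 * C / (sp - sm).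
have L0 : 0 < L by rewrite divr_gt0// mulr_gt0.
have [delta delta0 hd] := compact_unif_continuous sigma B csig (eta / L) (divr_gt0 eta0 L0).
have := hUAP K cK G (continuous_subspaceT (continuous_cV _ _ _ cG)) delta delta0.
apply: filterS => n [gh ghN ghG].
exists (fun w => map_mx (haff C sigma \o sigma) (gh w)); first by exists gh.
move=> w Kw i; rewrite mxE /= -sigG haff_sub -/L normrM (gtr0_norm L0) -ler_pdivlMl// mulrC.
apply/ltW/hd.
  apply: le_trans (GB w Kw); rewrite [leRHS]ger0_norm ?sumr_ge0// (bigD1 i)//= lerDl.
  exact: sumr_ge0.
have : ball_ (fun x => `|x|) (gh w) delta (G w) by exact: ghG.
by rewrite -mx_norm_ball => -[_ /(_ i ord0)].
Unshelve. all: by end_near. Qed.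

End network.

(** * The loss of a network *)

Section network_loss.
Context {R : realType} (d N : nat) (a b nu : R) (bc : BC) (ab : a < b).
Context (f : 'rV[R]_d -> R -> R) (C : R).
Local Notation A := (Abc bc N nu).
Local Notation F := (Fvec bc N d f).
Local Notation cl := (clamp d a b).
Context (cF : forall j, continuous (fun w => F (cl w) j ord0)).

Definition loss (alpha : 'rV[R]_d -> 'cV[R]_N.-1) w := sqn N.-1 (A *m alpha w - F w).

Lemma loss_ge0 alpha w : 0 <= loss alpha w.
Proof. exact: sqn_ge0. Qed.

Lemma loss_clamp_continuous alpha : continuous alpha ->
  continuous (fun w => loss alpha (cl w)).
Proof.
move=> ca; apply: sum_continuous => i.
have ci : continuous (fun w => (A *m alpha (cl w) - F (cl w)) i ord0).
  rewrite (_ : (fun w => _) = (fun w =>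
      \sum_k A i k * alpha (cl w) k ord0 - F (cl w) i ord0)); last first.
    by apply/funext => w; rewrite mxE mxE [in X in _ + X]mxE.
  apply: fun_subr_continuous; last exact: cF.
  apply: sum_continuous => k; apply: fun_mulr_continuous; first exact: cst_continuous.
  move=> w; apply: (@continuous_comp _ _ _ _ (fun v : 'cV[R]_N.-1 => v k ord0)).
    by apply: continuous_comp; [exact: clamp_continuous|exact: ca].
  exact: coord_continuous.
rewrite (_ : (fun w => _) = (fun w => (A *m alpha (cl w) - F (cl w)) i ord0 *
  (A *m alpha (cl w) - F (cl w)) i ord0)); last by apply/funext => w; rewrite expr2.
exact: fun_mulr_continuous.
Qed.

(** The bound depends on the coordinate bound C alone, so one constant serves every class at
    once. *)
Lemma loss_clamp_bounded : 0 <= C -> exists B : R, forall alpha : 'rV[R]_d -> 'cV[R]_N.-1,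
  (forall w i, `|alpha w i ord0| <= C) -> forall w, loss alpha (cl w) <= B.
Proof.
move=> C0; have cFs : continuous (fun w => \sum_j `|F (cl w) j ord0|).
  by apply: sum_continuous => j w; apply: continuous_comp; [exact: cF|exact: norm_continuous].
have [BF BF0 FB] := compact_bounded_fun _ _ _ (compact_Omega d a b) cFs.
(* Compactness bounds the load vector on the cube only; idempotence of [clamp] extends the bound to
   all w. *)
have FjB w j : `|F (cl w) j ord0| <= BF.
  apply: le_trans (FB _ (clamp_Omega d a b ab w)); rewrite [leRHS]ger0_norm ?sumr_ge0//.
  rewrite (clamp_id _ _ _ _ (clamp_Omega d a b ab w)).
  by rewrite (bigD1 j)//= lerDl sumr_ge0.
exists (\sum_i (\sum_k `|A i k| * C + BF) ^+ 2) => alpha aC w.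
apply: ler_sum => i _; rewrite -[leLHS]ger0_norm ?sqr_ge0// normrX lerXn2r ?nnegrE//.
  by rewrite addr_ge0// sumr_ge0// => k _; rewrite mulr_ge0.
rewrite mxE [X in _ + X]mxE [X in X + _]mxE; apply: le_trans (ler_normB _ _) _; apply: lerD => //.
apply: le_trans (ler_norm_sum _ _ _) _; apply: ler_sum => k _.
by rewrite normrM ler_wpM2l.
Qed.

Context (nu0 : 0 <= nu).

Lemma alphastar_clamp_continuous i :
  continuous (fun w => alphastar bc N d nu f (cl w) i ord0).
Proof.
rewrite (_ : (fun w => _) = (fun w => \sum_k invmx A i k * F (cl w) k ord0)); last first.
  by apply/funext => w; rewrite mxE.
by apply: sum_continuous => k; apply: fun_mulr_continuous; [exact: cst_continuous|exact: cF].
Qed.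

(** The residual equals A applied to the difference from [alphastar]. The condition eta <= 1 turns
    the quadratic bound into a linear one. *)
Lemma loss_le_dist : exists2 K : R, 0 <= K &
  forall (alpha : 'rV[R]_d -> 'cV[R]_N.-1) w eta, 0 <= eta <= 1 ->
  (forall i, `|alpha w i ord0 - alphastar bc N d nu f w i ord0| <= eta) ->
  loss alpha w <= K * eta.
Proof.
have [K K0 HK] := sqn_mulmx_le N.-1 N.-1 A.
exists (K * (N.-1)%:R); first by rewrite mulr_ge0.
move=> alpha w eta /andP[e0 e1] Ha.
have -> : loss alpha w = sqn N.-1 (A *m (alpha w - alphastar bc N d nu f w)).
  by rewrite mulmxBr mulKVmx// Abc_unit.
apply: le_trans (HK _) _; rewrite -mulrA ler_wpM2l//.
apply: (@le_trans _ _ (\sum_(i < N.-1) eta)); last by rewrite sumr_const card_ord mulr_natl.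
apply: ler_sum => i _; rewrite [X in X ^+ 2]mxE [X in _ + X]mxE.
rewrite -[leLHS]ger0_norm ?sqr_ge0// normrX expr2.
apply: le_trans (ler_pM _ _ (Ha i) (Ha i)) _ => //.
by rewrite ler_piMr.
Qed.

(** Conversely, the difference from [alphastar] is the inverse of A applied to the negated residual,
    so the squared H1 error is at most a constant times the loss, pointwise on [Omega]. *)
Lemma err2_le_loss (PO : probability 'rV[R]_d R) : exists2 K, 0 <= K & forall alpha e,
  mean d PO (fun w => loss alpha (cl w)) <= e ->
  PO.-integrable setT (fun w => (loss alpha (cl w))%:E) ->
  (err2 bc N d nu a b f PO alpha <= (K * e)%:E)%E.
Proof.
have [K K0 HK] := sqn_mulmx_le N.-1 N.-1 (invmx A).
have [K' K'0 HK'] := @H1sq_le R bc N.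
have V0 : 0 <= (b - a) ^+ d by rewrite exprn_ge0// subr_ge0 ltW.
exists ((b - a) ^+ d * (K' * K)); first by rewrite mulr_ge0// mulr_ge0.
move=> alpha e me ia; rewrite /err2 -mulrA EFinM; apply: lee_wpmul2l; first by rewrite lee_fin.
apply: (@le_trans _ _ (\int[PO]_w ((K' * K) * loss alpha (cl w))%:E)%E).
  rewrite integral_mkcond; apply: ge0_le_integral_nonmeas => w _; rewrite /patch;
    case: ifPn => // Ow; rewrite ?lee_fin ?mulr_ge0 ?loss_ge0//.
    by apply: integral_ge0 => x _; rewrite lee_fin addr_ge0// sqr_ge0.
  rewrite inE in Ow; rewrite (clamp_id _ _ _ _ Ow).
  have -> : upoly bc N (alphastar bc N d nu f w) - upoly bc N (alpha w) =
      upoly bc N (alphastar bc N d nu f w - alpha w).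
    by rewrite /upoly -sumrB; apply: eq_bigr => i _; rewrite !mxE scalerBl.
  apply: le_trans (HK' _) _; rewrite lee_fin -mulrA ler_wpM2l//.
  have -> : alphastar bc N d nu f w - alpha w = invmx A *m - (A *m alpha w - F w).
    by rewrite opprB mulmxBr mulKmx// Abc_unit.
  apply: le_trans (HK _) _; rewrite ler_wpM2l// /loss /sqn.
  by apply: ler_sum => i _; rewrite [X in X ^+ 2 <= _]mxE sqrrN.
under eq_integral do rewrite EFinM.
rewrite integralZl// [leRHS]EFinM; apply: lee_wpmul2l; first by rewrite lee_fin mulr_ge0.
rewrite -[leLHS]fineK ?lee_fin//; exact: integrable_fin_num.
Qed.

End network_loss.

(** * Almost sure convergence of the empirical minimizers *)

Theorem theorem4p3 (R : realType) (d N : nat) (a b nu : R) (bc : BC)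
  (hab0 : 0 < a) (hab : a < b) (hnu : 0 <= nu)
  (* f in C(Omega; L^1(I)) *)
  (f : 'rV[R]_d -> R -> R)
  (hfL1 : forall w, Omega d a b w ->
     (@lebesgue_measure R).-integrable I_int (fun x => (f w x)%:E))
  (hfC : forall w0, Omega d a b w0 -> forall eps : R, 0 < eps ->
     exists2 delta : R, 0 < delta & forall w, Omega d a b w -> `|w - w0| < delta ->
       (\int[@lebesgue_measure R]_(x in I_int) (`|f w x - f w0 x|)%:E < eps%:E)%E)
  (* the uniform law P_Omega on Omega = [a,b]^d *)
  (PO : probability 'rV[R]_d R)
  (hPO : forall B : 'I_d -> set R, (forall i, measurable (B i)) ->
     PO [set w | forall i, B i (w ord0 i)] = (\prod_(i < d) uniform_prob hab (B i))%E)
  (* network classes N_n^* : nested, continuous, universal approximators *)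
  (NNstar : nat -> set ('rV[R]_d -> 'cV[R]_(N.-1)))
  (hNNnest : forall n, NNstar n `<=` NNstar n.+1)
  (hNNcont : forall n g, NNstar n g -> continuous g)
  (hUAP : forall K : set 'rV[R]_d, compact K ->
     forall g : 'rV[R]_d -> 'cV[R]_(N.-1), {within K, continuous g} ->
     forall eps : R, 0 < eps -> \forall n \near \oo,
       exists2 gh, NNstar n gh & forall x, K x -> `|gh x - g x| < eps)
  (* bounded activation with continuous inverse *)
  (sigma : R -> R) (hsig_cont : continuous sigma) (hsig_inj : injective sigma)
  (hsig_bd : exists B : R, forall x, `|sigma x| <= B)
  (hsig_inv : exists2 sinv : R -> R, (forall x, sinv (sigma x) = x) &
                 {within range sigma, continuous sinv})
  (Calpha : R)
  (hC : (ereal_sup [set (eucl N.-1 (alphastar bc N d nu f w))%:E | w in Omega d a b]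
           < Calpha%:E)%E)
  (* i.i.d. samples omega_1, omega_2, ... ~ P_Omega *)
  (dT : measure_display) (T : measurableType dT) (P : probability T R)
  (omega : nat -> T -> 'rV[R]_d)
  (homega_meas : forall m, measurable_fun setT (omega m))
  (homega_law : forall m (A : set 'rV[R]_d), measurable A ->
     P (omega m @^-1` A) = PO A)
  (homega_indep : forall (k : nat) (A : nat -> set 'rV[R]_d),
     (forall j, measurable (A j)) ->
     P (\bigcap_(j in `I_k) (omega j @^-1` A j)) = (\prod_(j < k) P (omega j @^-1` A j))%E)
  (* minimizers of the empirical loss over N_n *)
  (alphahat : nat -> nat -> T -> 'rV[R]_d -> 'cV[R]_(N.-1))
  (halpha_in : forall n M t, NNclass d N.-1 Calpha sigma NNstar n (alphahat n M t))
  (halpha_min : forall n M t alpha, NNclass d N.-1 Calpha sigma NNstar n alpha ->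
     LossM bc N d nu a b f T omega M t (alphahat n M t) <= LossM bc N d nu a b f T omega M t alpha)
  (* Rademacher complexity hypothesis *)
  (hRad : forall n, (fun M => Rademacher dT T P d omega
              (Ftilde bc N d nu f (NNclass d N.-1 Calpha sigma NNstar n)) M) @ \oo --> 0%E) :
  {ae P, forall t, forall eps : R, 0 < eps ->
     \forall n \near \oo, \forall M \near \oo,
       (err2 bc N d nu a b f PO (alphahat n M t) < (eps ^+ 2)%:E)%E}.
Proof.
have [sinv sigK csinv] := hsig_inv.
have iomega := iid_subfamily d PO _ T P omega homega_meas homega_law homega_indep.
have cF := @Fvec_clamp_continuous R d N a b hab bc f hfL1 hfC.
(* The losses are composed with [clamp] so as to be continuous and uniformly bounded on the whole
   space; on [Omega] they are the members of [Ftilde]. *)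
pose G n : set ('rV[R]_d -> R) := [set (fun w => loss d N nu bc f alpha (clamp d a b w)) |
  alpha in NNclass d N.-1 Calpha sigma NNstar n].
have lt_star w i : `|alphastar bc N d nu f (clamp d a b w) i ord0| < Calpha.
  apply: le_lt_trans (le_coord_eucl _ _ _) _; rewrite -lte_fin; apply: le_lt_trans hC.
  apply: ereal_sup_ubound; exists (clamp d a b w) => //; exact: clamp_Omega.
have C0 : 0 < Calpha.
  rewrite -lte_fin; apply: le_lt_trans hC; apply: le_ereal_sup_tmp.
  exists (eucl N.-1 (alphastar bc N d nu f (clamp d a b 0)))%:E; last by rewrite lee_fin sqrtr_ge0.
  by exists (clamp d a b 0) => //; exact: clamp_Omega.
have NN_le n alpha : NNclass d N.-1 Calpha sigma NNstar n alpha ->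
    forall w i, `|alpha w i ord0| <= Calpha.
  move=> [g _ <-] w i; rewrite mxE /=.
  exact: (haff_sigma_le sigma sinv hsig_bd sigK _ _ (ltW C0)).
have NN_cont n alpha : NNclass d N.-1 Calpha sigma NNstar n alpha -> continuous alpha.
  move=> [g Ng <-]; apply: continuous_cV => i.
  rewrite (_ : (fun w => _) = (fun w =>
      2 * Calpha / (sigma_plus sigma - sigma_minus sigma) *
      (sigma (g w i ord0) - sigma_minus sigma) - Calpha)); last first.
    by apply/funext => w; rewrite mxE /= /haff; ring.
  apply: fun_subr_continuous; last exact: cst_continuous.
  apply: fun_mulr_continuous; first exact: cst_continuous.
  apply: fun_subr_continuous; last exact: cst_continuous.
  move=> w; apply: (@continuous_comp _ _ _ (fun w => g w i ord0) sigma); last exact: hsig_cont.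
  apply: (@continuous_comp _ _ _ g (fun v : 'cV[R]_N.-1 => v i ord0)); first exact: hNNcont Ng w.
  exact: coord_continuous.
have [B HB] := loss_clamp_bounded d N a b nu bc hab f Calpha cF (ltW C0).
have cG n g : G n g -> continuous g.
  by move=> [alpha Na <-]; apply: loss_clamp_continuous => //; exact: NN_cont Na.
have bG n g : G n g -> forall w, 0 <= g w <= B.
  by move=> [alpha Na <-] w; rewrite loss_ge0 HB//; exact: NN_le Na.
have [t0 _] : [set: T] !=set0.
  apply/set0P/eqP => T0; have := probability_setT P.
  by rewrite T0 measure0 => /eqP; rewrite eqe eq_sym oner_eq0.
have G0 n : G n !=set0 by eexists; exists (alphahat n 0 t0).
pose ES n m := (\int[P]_t supabs (m * d) (dev_class d PO (G n) m)
  (pack m d (fun i : 'I_m => omega (0 * m + i)%N t)))%E.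
(* One null set for all n and all block lengths [m.+1], by countable union; the block length is
   chosen later, depending on n. *)
have UL : {ae P, forall t, forall n m, forall e : R, 0 < e -> \forall M \near \oo,
    forall g, G n g -> M%:R * mean d PO g <=
      \sum_(i < M) g (omega i t) + M%:R * (fine (ES n m.+1) / m.+1%:R + e)}.
  apply: ae_foralln => n; apply: ae_foralln => m.
  exact: (ulln d PO (G n) B (G0 n) (cG n) (bG n) _ T P omega iomega m.+1).
have mOm := measurable_Omega d a b.
have POm : PO (~` Omega d a b) = 0%E.
  have Om1 : PO (Omega d a b) = 1%E.
    rewrite (_ : Omega d a b = [set w | forall i, `[a, b]%classic (w ord0 i)]); last first.
      by apply/seteqP; split => w /= h i; have := h i; rewrite /= in_itv.
    rewrite (hPO (fun=> `[a, b]%classic))//.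
    rewrite big1// => i _; rewrite /uniform_prob integral_uniform_pdf setIid.
    rewrite -[RHS](probability_setT (uniform_prob hab)).
    by rewrite /uniform_prob [RHS]integral_uniform_pdf setTI.
  by rewrite probability_setC// Om1 subee.
have aeOm i : P (omega i @^-1` (~` Omega d a b)) = 0%E.
  by rewrite homega_law//; exact: measurableC.
have inOm : {ae P, forall t, forall i, Omega d a b (omega i t)}.
  apply: ae_foralln => i; apply/negligibleP; last exact: aeOm.
  rewrite -[X in measurable X]/(omega i @^-1` (~` Omega d a b)) -[X in measurable X]setTI.
  by apply: homega_meas => //; exact: measurableC.
have EScmp n m : (ES n m.+1 <= (2 * m.+1%:R)%:E * Rademacher dT T P d omega
    (Ftilde bc N d nu f (NNclass d N.-1 Calpha sigma NNstar n)) m.+1)%E.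
  apply: (dev_le_rademacher d PO (G n) B (G0 n) (cG n) (bG n) _ T P omega iomega _ _ mOm aeOm) => //.
  move=> g [alpha Na <-]; exists (loss d N nu bc f alpha); first by exists alpha.
  by move=> w Ow; rewrite clamp_id.
have [K1 K10 HK1] := loss_le_dist d N nu bc f hnu.
have [K2 K20 HK2] := err2_le_loss d N a b nu bc hab f hnu PO.
have cOm := compact_Omega d a b.
have V0 : 0 < (b - a) ^+ d by rewrite exprn_gt0// subr_gt0.
move: UL inOm; apply: filterS2 => t UL inOm eps eps0.
(* The mean loss will be at most 4 delta, so the squared error is at most 4 K2 delta; the added 1
   makes the final inequality strict. *)
pose delta := eps ^+ 2 / (4 * K2 + 1).
have K2' : 0 < 4 * K2 + 1 by rewrite ltr_wpDl// mulr_ge0.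
have delta0 : 0 < delta by rewrite divr_gt0// exprn_gt0.
(* Small enough that [loss_le_dist] applies and gives a loss of at most delta for the approximating
   network. *)
pose eta := Num.min 1 (delta / (K1 + 1)).
have K1' : 0 < K1 + 1 by rewrite ltr_wpDl.
have eta0 : 0 < eta by rewrite /eta lt_min ltr01 divr_gt0.
have eta1 : eta <= 1 by rewrite /eta ge_min lexx.
have etad : K1 * eta <= delta.
  apply: (@le_trans _ _ ((K1 + 1) * eta)); first by rewrite ler_wpM2r ?lerDl// ltW.
  by rewrite mulrC -ler_pdivlMr// /eta ge_min lexx orbT.
have := NN_approx sigma sinv hsig_cont hsig_bd sigK csinv d N.-1 Calpha NNstar hUAP _ _ cOm C0
  (alphastar_clamp_continuous d N a b nu bc f cF) lt_star eta eta0.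
apply: filterS => n [alpha Na approx].
have alpha_loss w : Omega d a b w -> loss d N nu bc f alpha w <= delta.
  move=> Ow; apply: le_trans etad; apply: HK1; first by rewrite ltW.
  by move=> i; have := approx w Ow i; rewrite clamp_id.
(* With n fixed, a single block length with small Rademacher complexity suffices. *)
have [m Rm] : exists m, (Rademacher dT T P d omega
    (Ftilde bc N d nu f (NNclass d N.-1 Calpha sigma NNstar n)) m.+1 < delta%:E)%E.
  have := hRad n => /(_ [set x | (x < delta%:E)%E]) [].
    exists delta => //= r; rewrite /ball_/= sub0r normrN => rd.
    by rewrite lte_fin (le_lt_trans (ler_norm _)).
  by move=> m0 _ /(_ m0.+1 (leqnSn _)) H; exists m0.
have ESn : fine (ES n m.+1) / m.+1%:R <= 2 * delta.
  have ES_le : (ES n m.+1 <= (2 * delta * m.+1%:R)%:E)%E.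
    apply: le_trans (EScmp n m) _; rewrite mulrAC [leRHS]EFinM.
    by apply: lee_wpmul2l (ltW Rm); rewrite lee_fin mulr_ge0.
  have ES_ge0 : (0 <= ES n m.+1)%E.
    apply: integral_ge0 => t' _; apply: supabs_ge0.
    by have [g Gg] := G0 n; eexists; exists g.
  rewrite ler_pdivrMr// -lee_fin fineK// ge0_fin_numE//.
  exact: le_lt_trans ES_le (ltry _).
have := UL n m delta delta0.
(* The successor makes M positive, so the empirical averages are meaningful. *)
move=> [M0 _ HM]; exists M0.+1 => // M /= M0M.
have M0' : (0 : R) < M%:R by rewrite ltr0n (leq_trans _ M0M).
have {}HM := HM M (ltnW M0M); rewrite /= in HM.
set ah := alphahat n M t.
have Nah : NNclass d N.-1 Calpha sigma NNstar n ah by exact: halpha_in.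
have Gah : G n (fun w => loss d N nu bc f ah (clamp d a b w)) by exists ah.
have {}HM := HM _ Gah.
(* By minimality the empirical loss is at most that of the approximating network, which is at most
   delta at every sample. *)
have emp : \sum_(i < M) loss d N nu bc f ah (clamp d a b (omega i t)) <= M%:R * delta.
  apply: (@le_trans _ _ (\sum_(i < M) loss d N nu bc f alpha (omega i t))); last first.
    apply: (@le_trans _ _ (\sum_(i < M) delta)); last by rewrite sumr_const card_ord mulr_natl.
    by apply: ler_sum => i _; exact: alpha_loss.
  under eq_bigr do rewrite clamp_id//.
  have := halpha_min n M t alpha Na; rewrite /LossM ler_pM2l//.
  by rewrite divr_gt0.
(* The 4 delta consist of delta for the empirical loss, 2 delta for the Rademacher term and delta
   for the slack in the uniform law. *)
have mle : mean d PO (fun w => loss d N nu bc f ah (clamp d a b w)) <= 4 * delta.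
  rewrite -(ler_pM2l M0'); apply: le_trans HM _.
  apply: le_trans (lerD emp (ler_wpM2l (ltW M0') (lerD ESn (lexx _)))) _.
  by rewrite -mulrDr; apply: ler_wpM2l; [exact: ltW|lra].
have int_ah : PO.-integrable setT (fun w => (loss d N nu bc f ah (clamp d a b w))%:E).
  apply: (bounded_integrable _ _ PO _ B).
    exact: (measurable_class d (G n) (cG n) _ Gah).
  by move=> w; rewrite ger0_norm ?loss_ge0//; case/andP: (bG n _ Gah w).
apply: le_lt_trans (HK2 _ _ mle int_ah) _.
have deltaE : (4 * K2 + 1) * delta = eps ^+ 2 by rewrite /delta mulrC divfK// gt_eqF.
by rewrite lte_fin -deltaE mulrCA mulrA ltr_pM2r// ltrDl.
Qed.
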